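(* Let $E$ be a finite nonempty set and $e\notin E$. Let $\tau(\mathbb{B}(E))$ be the truncation of the Boolean algebra $\mathbb{B}(E)$ of all subsets of $E$. If $\mathcal{M}=\emptyset$ or $\mathcal{M}$ is a principal modular cut of $\tau(\mathbb{B}(E))$, then the chain polynomial of the single-element extension $\tau(\mathbb{B}(E))+_{\mathcal{M}}e$ is real-rooted with all zeros in $[-1,0]$.
   Context: The chain polynomial of a finite poset $P$ is $c_P=\sum_{k\ge 0}c_k(P)t^k$, where $c_k(P)$ is the number of $k$-element chains of $P$. The truncation $\tau(P)$ of a finite graded poset $P$ of rank $r>0$ is the poset obtained from $P$ by removing all elements of rank $r-1$. Thus $\tau(\mathbb{B}(E))$ consists of all subsets of $E$ of cardinality different from $|E|-1$, ordered by inclusion. Let $L$ be a finite geometric lattice (graded, semimodular, atomistic) with rank function $\rho$. A modular cut $\mathcal{M}$ of $L$ is a collection of elements of $L$ such that: (i) if $x\in\mathcal{M}$ and $y\in L$ with $x\le y$, then $y\in\mathcal{M}$; (ii) if $x,y\in\mathcal{M}$ is a modular pair, i.e. $\rho(x)+\rho(y)=\rho(x\wedge y)+\rho(x\vee y)$, then $x\wedge y\in\mathcal{M}$. It is principal if $\mathcal{M}=\{z\in L:z\ge x\}$ for some $x\in L$. Let $A$ be the set of atoms of $L$, and identify each $x\in L$ with the set $X=\{a\in A:a\le x\}$ (so $\hat 0$ corresponds to $\emptyset$). For $e\notin A$, the single-element extension $L+_{\mathcal{M}}e$ is the geometric lattice, ordered by inclusion, whose elements are: (i) the sets $X\in L$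 with $X\notin\mathcal{M}$; (ii) the sets $X\cup\{e\}$ with $X\in\mathcal{M}$; (iii) the sets $X\cup\{e\}$ where $X\in L$, $X\notin\mathcal{M}$, and there is no $Y\in\mathcal{M}$ with $X\subseteq Y$ and $\rho(Y)=\rho(X)+1$. *)

(* Defs.v *)
From HB Require Import structures.
From mathcomp Require Import all_boot all_order all_algebra.
From mathcomp Require Import reals.
From mathcomp.real_closed Require Import complex.

Set Implicit Arguments.
Unset Strict Implicit.
Unset Printing Implicit Defensive.

Import Order.Theory Order.DefaultSetSubsetOrder GRing.Theory Num.Theory.

Local Open Scope order_scope.

Section Posets.
Context {d : Order.disp_t} (P : finPOrderType d).

Definition is_chain (C : {set P}) : bool :=
  [forall x in C, forall y in C, x >=< y].

Definition nb_chains (k : nat) : nat := #|[set C | is_chain C && (#|C| == k)]|.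

Definition chain_poly (R : nzRingType) : {poly R} :=
  \poly_(k < #|P|.+1) (nb_chains k)%:R%R.

(* The length of a longest chain x_0 < ... < x_k = x; this is the rank function
   of a graded poset. *)
Definition rank (x : P) : nat :=
  \max_(C : {set P} | is_chain C && [forall y in C, y < x]) #|C|.

Definition poset_rank : nat := \max_(x : P) rank x.

Definition is_least (z : P) : bool := [forall y, z <= y].

Definition covers (x y : P) : bool :=
  (x < y) && ~~ [exists z, (x < z) && (z < y)].

Definition atom (a : P) : bool := [exists z, is_least z && covers z a].

End Posets.

Section Subposet.
Context {d : Order.disp_t} (P : finPOrderType d) (S : {set P}).

Record subposet : Type :=
  Subposet { subposet_val :> P; _ : subposet_val \in S }.

HB.instance Definition _ := [isSub for subposet_val].
HB.instance Definition _ := [Finite of subposet by <:].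
HB.instance Definition _ := [SubChoice_isSubPOrder of subposet by <: with d].
End Subposet.

(* Only meaningful when P is graded of positive rank. *)
Definition truncation d (P : finPOrderType d) : Type :=
  subposet [set x : P | rank x != (poset_rank P).-1].

Section SubsetRank.
Variable E : finType.
Implicit Types A B : {set E}.

Lemma lt_rank d (P : finPOrderType d) (x y : P) :
  x < y -> (rank x < rank y)%N.
Proof.
move=> xy.
have /(eq_bigmax_cond (fun C : {set P} => #|C|)) [C] :
    (0 < #|[pred C : {set P} | is_chain C && [forall y in C, (y < x)%O]]|)%N.
  apply/card_gt0P; exists set0; rewrite !inE.
  by apply/andP; split; apply/forall_inP => z; rewrite inE.
rewrite inE => /andP[Cch /forall_inP Cx] rk.
rewrite {1}/rank; rewrite (_ : \max_(_ | _) _ = #|C|)//.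
have xC : x \notin C by apply/negP => /Cx; rewrite ltxx.
have <- : #|x |: C| = #|C|.+1 by rewrite cardsU1 xC.
apply: (@leq_bigmax_cond _ _ (fun C : {set P} => #|C|)); apply/andP; split.
  apply/forall_inP => u /setU1P uC; apply/forall_inP => v /setU1P vC.
  case: uC vC => [->|uC] [->|vC].
  - exact: comparablexx.
  - by rewrite comparable_sym lt_comparable// Cx.
  - by rewrite lt_comparable// Cx.
  - by move/forall_inP: Cch => /(_ _ uC) /forall_inP /(_ _ vC).
apply/forall_inP => u /setU1P [->//|uC].
exact: lt_trans (Cx _ uC) xy.
Qed.

Lemma rank_subset A : rank A = #|A|.
Proof.
apply/eqP; rewrite eqn_leq; apply/andP; split; last first.
  move: {2}#|A| (erefl #|A|) => n.
  elim: n A => [|n IHn] A cA; first by rewrite cA.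
  have /card_gt0P [x xA] : (0 < #|A|)%N by rewrite cA.
  have c : #|A :\ x| = n by move: cA; rewrite (cardsD1 x) xA => -[].
  have lt : (A :\ x : {set E}) < A.
    rewrite lt_neqAle; apply/andP; split; last exact: subD1set.
    by apply/eqP => /setP /(_ x); rewrite !inE xA eqxx.
  by rewrite cA (leq_ltn_trans _ (lt_rank lt))// -[leqLHS]c IHn.
apply/bigmax_leqP => C /andP[/forall_inP Cch /forall_inP CA].
rewrite cardE -(size_map (fun B : {set E} => #|B|)) -[leqRHS](size_iota 0).
apply: uniq_leq_size.
  rewrite map_inj_in_uniq ?enum_uniq// => U V; rewrite !mem_enum => UC VC cUV.
  have /forall_inP /(_ _ VC) := Cch _ UC.
  move=> /orP[]; rewrite Order.SetSubsetOrder.leEsubset => s; last apply: esym.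
    by apply/eqP; rewrite eqEcard s cUV /=.
  by apply/eqP; rewrite eqEcard s cUV /=.
move=> k /mapP[B]; rewrite mem_enum => /CA BA ->.
by rewrite mem_iota add0n leq0n /= proper_card.
Qed.

Lemma poset_rank_subset : poset_rank {set E} = #|E|.
Proof.
apply/eqP; rewrite eqn_leq; apply/andP; split.
  by apply/bigmax_leqP => A _; rewrite rank_subset max_card.
by rewrite -cardsT -rank_subset (leq_bigmax (setT : {set E})).
Qed.

End SubsetRank.

Definition trunc_bool (E : finType) : Type := truncation {set E}.

HB.instance Definition _ (E : finType) := Finite.on (trunc_bool E).
HB.instance Definition _ (E : finType) := SubType.on (trunc_bool E).
HB.instance Definition _ (E : finType) := Order.POrder.on (trunc_bool E).

Section TruncBoolLattice.
Variable E : finType.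
Local Notation L := (trunc_bool E).
Implicit Types x y z : L.

Lemma in_trunc_bool (A : {set E}) :
  (A \in [set B : {set E} | rank B != (poset_rank {set E}).-1])
  = (#|A| != #|E|.-1).
Proof. by rewrite inE rank_subset poset_rank_subset. Qed.

(* insubd takes a default value: in tb_meet it is never used, and in tb_join it
   is used exactly when the union has #|E| - 1 elements. *)
Definition tb_meet x y : L := insubd x (val x `&` val y).
Definition tb_join x y : L :=
  insubd (insubd x ([set: E] : {set E})) (val x `|` val y).

Lemma tb_leE x y : (x <= y) = (val x \subset val y).
Proof. by []. Qed.

Lemma card_tb x : #|val x| != #|E|.-1.
Proof. by rewrite -in_trunc_bool; case: x. Qed.

Lemma tb_top x : (#|val x| < #|E|.-1)%N \/ val x = [set: E].
Proof.
have := card_tb x; have := max_card (mem (val x)).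
rewrite leq_eqVlt => /orP[/eqP c _|]; last first.
  case: #|E| => // n; rewrite ltnS leq_eqVlt.
  move=> /orP[/eqP->|]; first by rewrite eqxx.
  by left.
by right; apply/eqP; rewrite eqEcard subsetT cardsT c leqnn.
Qed.

Lemma val_tb_meet x y : val (tb_meet x y) = val x :&: val y.
Proof.
rewrite insubdK// in_trunc_bool Order.SetSubsetOrder.meetEsubset.
case: (tb_top x) => [lt|->]; last by rewrite setTI card_tb.
by rewrite neq_ltn (leq_ltn_trans _ lt)// subset_leq_card// subsetIl.
Qed.

Lemma tb_meetP x y z : (x <= tb_meet y z) = (x <= y) && (x <= z).
Proof. by rewrite !tb_leE val_tb_meet subsetI. Qed.

Lemma tb_joinP x y z : (tb_join x y <= z) = (x <= z) && (y <= z).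
Proof.
rewrite !tb_leE -subUset /tb_join val_insubd in_trunc_bool.
rewrite Order.SetSubsetOrder.joinEsubset.
case: ifPn => //; rewrite negbK => /eqP cU.
have E0 : (0 < #|E|)%N.
  rewrite lt0n; apply/eqP => E0; have := card_tb x.
  by rewrite E0 -leqn0 -[X in (_ <= X)%N]E0 max_card.
rewrite insubdK; last by rewrite in_trunc_bool cardsT -{1}(prednK E0) gtn_eqF.
apply/idP/idP => [/(subset_trans (subsetT _))//|].
case: (tb_top z) => [lt /subset_leq_card|->]; last by rewrite subxx.
by rewrite cU leqNgt lt.
Qed.

HB.instance Definition _ :=
  Order.POrder_MeetJoin_isLattice.Build _ L tb_meetP tb_joinP.

End TruncBoolLattice.

Section Extension.
Context {d : Order.disp_t} (L : finLatticeType d).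
Implicit Types (M : {set L}) (x y z : L).

Definition modular_pair x y : bool :=
  (rank x + rank y == rank (x `&` y) + rank (x `|` y))%N.

Definition modular_cut M : Prop :=
  (forall x y, x \in M -> x <= y -> y \in M) /\
  (forall x y, x \in M -> y \in M -> modular_pair x y -> x `&` y \in M).

Definition principal M : Prop := exists x, M = [set z | x <= z].

(* The ground set A + e of the extension is modelled inside option L, with the
   atom a as Some a and the new element e as None. *)
Definition atoms_below x : {set option L} :=
  [set Some a | a : L & atom a && (a <= x)].

Definition extension_elements M : {set {set option L}} :=
  [set atoms_below x | x : L & x \notin M]
  :|: [set None |: atoms_below x | x : L & x \in M]
  :|: [set None |: atoms_below x | x : L &
        (x \notin M) &&
        ~~ [exists y in M, (atoms_below x \subset atoms_below y)
                           && (rank y == (rank x).+1)]].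

Definition extension M : Type := subposet (extension_elements M).

HB.instance Definition _ M := Order.FinPOrder.on (extension M).

End Extension.

Local Open Scope ring_scope.

Definition real_rooted (R : realType) (p : {poly R}) : Prop :=
  forall z : R[i], root (map_poly (real_complex R) p) z -> complex.Im z = 0.

(* Main.v *)
Require Import Defs.
From HB Require Import structures.
From mathcomp Require Import all_boot all_order all_algebra.
From mathcomp Require Import reals ring lra zify.
From mathcomp.real_closed Require Import complex.

Set Implicit Arguments.
Unset Strict Implicit.
Unset Printing Implicit Defensive.

Import Order.Theory Order.DefaultSetSubsetOrder GRing.Theory Num.Theory.

Local Open Scope ring_scope.

(** Let [E] have at least two elements, let [L] be the truncation of its Boolean
    algebra and let [F] be the bottom of the cut. Adding [e] freely to the flat [F] of the Boolean algebra creates a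
    matroid on [E + e] whose only circuit is [C = F + e]; its lattice of flats is
    the product of a truncated Boolean algebra (the part inside [C]) with a
    Boolean algebra (the part outside [C]), and the extension of [L] by the
    principal cut above [F] is the truncation of that product. For the empty cut
    the extension is that same kind of product itself, with [C = E]; for
    [F] empty it is isomorphic to [L]. So everything is about the families
    [circuit_flats] and [trunc_circuit_flats].

    For a flat [S] let [wt S] be the sum of [t^j] over the chains of [j] steps from
    the bottom to [S]. The chain polynomial is [(1 + t)^2] times the sum of [wt S]
    over the flats other than the top ([chain_poly_bounded]). Adjoining to [S]
    an element outside [C] acts on [wt] by the operator
    [subdivX f = t ((1 + t) f)'], which yields closed formulas for these sums
    ([sum_circuit_wt], [sum_trunc_circuit_wt]) as real polynomials in one variable.

    Such a polynomial has all its zeros real if it does not vanish on the open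
    upper half plane ([stable]). Interlacing of the zeros of [f] and [g] is handled
    there as well: it is expressed by the condition that [g(z) / f(z)] lies in the
    sector spanned by [1] and [z] ([sector]). This condition is additive in [f] and
    in [g], and a Gauss-Lucas argument shows that [subdivX] preserves it
    ([sector_subdivX]). Truncation replaces a generating function [g] by
    [g - t (sum of the generating functions of the coatoms)]; when the second sum
    interlaces [g], strictly in the sense of the sector condition, the difference
    has no zero in the upper half plane ([stable_trunc_prod_poly]).

    Finally a real zero must lie in [[-1, 0]] because the polynomials are
    nonnegative combinations of the [t^i (1 + t)^(d - i)], that is, their
    h-polynomials have nonnegative coefficients ([hpos]). *)

(** * The subdivision operator and multiplication by x and x + 1 *)

Section Operators.
Variable R : comNzRingType.
Implicit Types f g : {poly R}.

(** The linear map sending the polynomial [binomial(x, k)] to [t^k] turns the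
    number of multichains of length [x] into the generating function of chains by
    number of steps. It intertwines multiplication by [x] with [subdivX] and
    multiplication by [x + 1] with [subdivX1]; the formulas below avoid defining
    the map. *)
Definition subdivX f : {poly R} := 'X * (('X + 1) * f)^`().
Definition subdivX1 f : {poly R} := ('X + 1) * ('X * f)^`().
(** The common reduction of [subdivX] and [subdivX1] once the factor [t],
    respectively [1 + t], has been taken out of the argument and of the value. *)
Definition subdivU f : {poly R} := ('X * ('X + 1) * f)^`().

Lemma subdivX_is_linear : linear subdivX.
Proof.
by move=> a f g; rewrite /subdivX mulrDr derivD -scalerAr derivZ mulrDr scalerAr.
Qed.
HB.instance Definition _ :=
  GRing.isLinear.Build R {poly R} {poly R} _ subdivX subdivX_is_linear.

Lemma subdivX1E f : subdivX1 f = subdivX f + f.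
Proof.
rewrite /subdivX1 /subdivX !derivM derivD derivX derivC; ring.
Qed.

Lemma subdivX1_is_linear : linear subdivX1.
Proof. by move=> a f g; rewrite !subdivX1E linearP /= scalerDr; ring. Qed.
HB.instance Definition _ :=
  GRing.isLinear.Build R {poly R} {poly R} _ subdivX1 subdivX1_is_linear.

Lemma subdivX_mulX f : subdivX ('X * f) = 'X * subdivU f.
Proof. by rewrite /subdivX /subdivU mulrA [('X + 1) * _]mulrC. Qed.

Lemma subdivX1_mulX1 f : subdivX1 (('X + 1) * f) = ('X + 1) * subdivU f.
Proof. by rewrite /subdivX1 /subdivU mulrA. Qed.

Lemma subdivX_X1C f : subdivX (subdivX1 f) = subdivX1 (subdivX f).
Proof. by rewrite !subdivX1E linearD. Qed.

Lemma iter_subdivX_X1C i f : iter i subdivX (subdivX1 f) = subdivX1 (iter i subdivX f).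
Proof. by elim: i => //= i ->; rewrite subdivX_X1C. Qed.

Lemma iter_subdivX_mulX i f : iter i subdivX ('X * f) = 'X * iter i subdivU f.
Proof. by elim: i => //= i ->; rewrite subdivX_mulX. Qed.

Lemma iter_subdivX1_mulX1 i f : iter i subdivX1 (('X + 1) * f) = ('X + 1) * iter i subdivU f.
Proof. by elim: i => //= i ->; rewrite subdivX1_mulX1. Qed.

Lemma subdivX_1 : subdivX 1 = 'X.
Proof. by rewrite /subdivX mulr1 derivD derivX derivC addr0 mulr1. Qed.

Lemma subdivX1_1 : subdivX1 1 = 'X + 1.
Proof. by rewrite subdivX1E subdivX_1. Qed.

Lemma iterS_subdivX_1 i : iter i.+1 subdivX 1 = 'X * iter i subdivU 1.
Proof. by rewrite iterSr subdivX_1 -[in LHS](mulr1 'X) iter_subdivX_mulX. Qed.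

Lemma iterS_subdivX1_1 i : iter i.+1 subdivX1 1 = ('X + 1) * iter i subdivU 1.
Proof. by rewrite iterSr subdivX1_1 -[in LHS](mulr1 ('X + 1)) iter_subdivX1_mulX1. Qed.

Fact iter_linear_proof (L : {linear {poly R} -> {poly R}}) i :
  linear (iter i L).
Proof. by elim: i => [|i IH] a f g; rewrite ?iterS ?[iter i L _]IH ?linearP. Qed.
HB.instance Definition _ (L : {linear {poly R} -> {poly R}}) i :=
  GRing.isLinear.Build R {poly R} {poly R} _ (iter i L)
    (@iter_linear_proof L i).

End Operators.

Arguments subdivX {R} f.
Arguments subdivX1 {R} f.
Arguments subdivU {R} f.

Section TruncatedDifference.
Variable R : comNzRingType.
Implicit Types f g : {poly R}.

(** Transport of multiplication by [(x + 1)^m - x^m - m x^(m - 1)]: all subsets of an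
    [m]-set, minus the whole set, minus its [m] coatoms. *)
Definition trunc_diff m f : {poly R} :=
  iter m subdivX1 f - iter m subdivX f - iter m.-1 subdivX f *+ m.

Lemma trunc_diff0 f : trunc_diff 0 f = 0.
Proof. by rewrite /trunc_diff /= mulr0n subr0 subrr. Qed.

Lemma trunc_diff1 f : trunc_diff 1 f = 0.
Proof. by rewrite /trunc_diff /= subdivX1E mulr1n; ring. Qed.

Lemma trunc_diffS m f : trunc_diff m.+1 f = subdivX1 (trunc_diff m f) + iter m.-1 subdivX f *+ m.
Proof.
case: m => [|m].
  by rewrite trunc_diff0 trunc_diff1 linear0 mulr0n addr0.
rewrite /trunc_diff /= !linearB /= !subdivX1E [subdivX (_ *+ _)]raddfMn /= [_ *+ m.+2]mulrSr.
by move: (subdivX (iter m subdivX f) *+ m.+1) => a; ring.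
Qed.

(** This transports [(x + 1)^(m + 2) - x^(m + 2) - (m + 2) x^(m + 1)
    = sum_s (s + 1) x^s (x + 1)^(m - s)]. All the terms raise the degree by [m], which
    the terms of the expansion in powers of [x] would not do. *)
Lemma trunc_diffE m f :
  trunc_diff m.+2 f = \sum_(s < m.+1) iter s subdivX (iter (m - s) subdivX1 f) *+ s.+1.
Proof.
elim: m => [|m IH].
  by rewrite trunc_diffS trunc_diff1 linear0 add0r big_ord_recl big_ord0 addr0.
rewrite trunc_diffS IH [in RHS]big_ord_recr /= subnn raddf_sum /=; congr (_ + _).
by apply: eq_bigr => s _; rewrite linearMn /= -iter_subdivX_X1C subSn// -ltnS.
Qed.

(** The coefficient of [t^j] is the number of chains of [j] steps from bottom to top
    in the Boolean algebra of rank [k], i.e. of surjections from [k] points onto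
    [j] points. *)
Definition surj_poly k : {poly R} := iter k subdivX 1.

(** [t * trunc_poly k] counts the chains from bottom to top in the truncated Boolean
    algebra on [k + 2] points. *)
Definition trunc_poly k : {poly R} := trunc_diff k.+2 1.

(** [t * trunc_prod_poly m k] counts the chains from bottom to top in the truncation
    of the product of the truncated Boolean algebra on [k + 2] points with the
    Boolean algebra on [m] points, for [m + k > 0]: the two subtracted terms are the two kinds of
    coatoms of the product. *)
Definition trunc_prod_poly m k : {poly R} :=
  iter m subdivU (trunc_poly k) - iter m.-1 subdivX ('X * trunc_poly k) *+ m
    - iter m subdivX (surj_poly k) *+ 'C(k.+2, 2).

End TruncatedDifference.

Arguments surj_poly : simpl never.

(** * Polynomials with a nonnegative h-polynomial *)

Section NonnegativeH.
Variable R : realDomainType.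
Implicit Types f g : {poly R}.

(** After the substitution [t = u / (1 - u)] and clearing of denominators,
    [t^i (1 + t)^(d - i)] becomes [u^i]. *)
Inductive hpos (d : nat) : {poly R} -> Prop :=
| hpos0 : hpos d 0
| hposD (a : R) i f : 0 <= a -> (i <= d)%N -> hpos d f ->
    hpos d (a *: ('X ^+ i * ('X + 1) ^+ (d - i)) + f).

Lemma hpos_monomial d i : (i <= d)%N -> hpos d ('X ^+ i * ('X + 1) ^+ (d - i)).
Proof.
by move=> id; rewrite -[X in hpos d X]addr0 -[X in X + 0]scale1r; apply: hposD;
  rewrite ?ler01//; apply: hpos0.
Qed.

Lemma hpos_add d f g : hpos d f -> hpos d g -> hpos d (f + g).
Proof.
move=> hf hg; elim: hf => [|a i {}f a0 id _ IH]; first by rewrite add0r.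
by rewrite -addrA; apply: hposD.
Qed.

Lemma hpos_scale d (a : R) f : 0 <= a -> hpos d f -> hpos d (a *: f).
Proof.
move=> a0; elim=> [|b i g b0 id _ IH]; first by rewrite scaler0; apply: hpos0.
by rewrite scalerDr scalerA; apply: hposD => //; rewrite mulr_ge0.
Qed.

Lemma hpos_muln d n f : hpos d f -> hpos d (f *+ n).
Proof. by move=> hf; rewrite -scaler_nat; apply: hpos_scale; rewrite ?ler0n. Qed.

Lemma hpos_sum d (I : Type) (s : seq I) (P : pred I) (F : I -> {poly R}) :
  (forall i, P i -> hpos d (F i)) -> hpos d (\sum_(i <- s | P i) F i).
Proof. by move=> hF; elim/big_ind: _ => //; [apply: hpos0|apply: hpos_add]. Qed.

Lemma hpos_linear (L : {linear {poly R} -> {poly R}}) d e f :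
  (forall i, (i <= d)%N -> hpos e (L ('X ^+ i * ('X + 1) ^+ (d - i)))) ->
  hpos d f -> hpos e (L f).
Proof.
move=> hL; elim=> [|a i g a0 id _ IH]; first by rewrite linear0; apply: hpos0.
by rewrite linearP /=; apply: hpos_add => //; apply: hpos_scale; [|apply: hL].
Qed.

Lemma hpos_one : hpos 0 1.
Proof. by rewrite -[X in hpos _ X](mulr1 1); apply: (@hpos_monomial 0 0). Qed.

Lemma hpos_mulX d f : hpos d f -> hpos d.+1 ('X * f).
Proof.
elim=> [|a i g a0 id _ IH]; first by rewrite mulr0; apply: hpos0.
by rewrite mulrDr -scalerAr mulrA -exprS -subSS; apply: hposD.
Qed.

Lemma deriv_monomialXX1 i j :
  ('X ^+ i.+1 * ('X + 1) ^+ j.+1 : {poly R})^`() =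
  ('X ^+ i * ('X + 1) ^+ j.+1) *+ i.+1 + ('X ^+ i.+1 * ('X + 1) ^+ j) *+ j.+1.
Proof.
rewrite derivM !derivXn deriv_exp derivD derivX derivC addr0 mul1r /=.
by rewrite mulrnAl mulrnAr.
Qed.

Lemma hpos_subdivU d f : hpos d f -> hpos d.+1 (subdivU f).
Proof.
elim=> [|a i g a0 id _ IH].
  by rewrite /subdivU mulr0 deriv0; apply: hpos0.
rewrite /subdivU mulrDr derivD -scalerAr derivZ; apply: hpos_add => //.
apply: hpos_scale => //.
rewrite mulrACA -!exprS deriv_monomialXX1; apply: hpos_add; apply: hpos_muln.
  by rewrite -subSn//; apply: hpos_monomial; apply: leqW.
by rewrite -subSS; apply: hpos_monomial.
Qed.

Lemma hpos_subdivX d f : hpos d f -> hpos d.+1 (subdivX f).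
Proof.
apply: hpos_linear => -[_|i id] /=; rewrite /subdivX mulrCA -exprS.
  rewrite mul1r subn0 deriv_exp derivD derivX derivC addr0 mul1r /= mulrnAr.
  apply: hpos_muln.
  by have := @hpos_monomial d.+1 1 isT; rewrite expr1 subSS subn0.
rewrite deriv_monomialXX1 mulrDr !mulrnAr !mulrA -!exprS.
apply: hpos_add; apply: hpos_muln.
  by rewrite -subSn//; apply: hpos_monomial; apply: leqW.
by rewrite -subSS; apply: hpos_monomial.
Qed.

Lemma hpos_subdivX1 d f : hpos d f -> hpos d.+1 (subdivX1 f).
Proof.
apply: hpos_linear => i id /=; rewrite /subdivX1 mulrA -exprS.
move dj: (d - i)%N => [|j].
  rewrite expr0 mulr1 derivXn mulrnAr; apply: hpos_muln.
  rewrite mulrC -[X in _ * X]expr1 (_ : 1 = d.+1 - i)%N; last by rewrite subSn// dj.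
  by apply: hpos_monomial; apply: leqW.
rewrite deriv_monomialXX1 mulrDr !mulrnAr ![('X + 1) * _]mulrCA -!exprS.
apply: hpos_add; apply: hpos_muln; rewrite -dj.
  by rewrite -subSn//; apply: hpos_monomial; apply: leqW.
by rewrite -subSS; apply: hpos_monomial.
Qed.

Lemma hpos_iter (op : {poly R} -> {poly R}) m d f :
  (forall e g, hpos e g -> hpos e.+1 (op g)) ->
  hpos d f -> hpos (m + d) (iter m op f).
Proof. by move=> hop hf; elim: m => //= m IH; rewrite addSn; apply: hop. Qed.

Lemma hpos_trunc_diff m d f : hpos d f -> hpos (m + d) (trunc_diff m.+2 f).
Proof.
move=> hf; rewrite trunc_diffE; apply: hpos_sum => -[s /= sm] _; apply: hpos_muln.
have -> : (m + d = s + ((m - s) + d))%N by rewrite addnA subnKC.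
by apply: (hpos_iter _ hpos_subdivX); apply: (hpos_iter _ hpos_subdivX1).
Qed.

Lemma hpos_iter_sub m d f :
  hpos d f -> hpos (m + d) (iter m.+1 subdivX1 f - iter m.+1 subdivX f).
Proof.
move=> hf; elim: m => [|m IH]; first by rewrite /= subdivX1E addrAC subrr add0r.
rewrite (_ : _ - _ = subdivX1 (iter m.+1 subdivX1 f - iter m.+1 subdivX f) + iter m.+1 subdivX f).
  by apply: hpos_add; [apply: hpos_subdivX1 | apply: (hpos_iter m.+1 hpos_subdivX)].
by rewrite linearB /= !subdivX1E; ring.
Qed.

Lemma hpos_gt0 d f (x : R) : hpos d f -> f != 0 -> 0 < x -> 0 < f.[x].
Proof.
move=> hf f0 x0; suff: 0 <= f.[x] /\ (f.[x] = 0 -> f = 0).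
  by move=> [fx f0']; rewrite lt_neqAle fx andbT eq_sym; apply: contra_neq f0.
elim: hf => {f f0} [|a i f a0 id _ [fx f0]]; first by rewrite horner0.
have m0 : 0 < ('X ^+ i * ('X + 1) ^+ (d - i)).[x].
  by rewrite !hornerE mulr_gt0 ?exprn_gt0// addr_gt0.
have am : 0 <= a * ('X ^+ i * ('X + 1) ^+ (d - i)).[x] by rewrite mulr_ge0// ltW.
rewrite hornerD hornerZ; split; first by rewrite addr_ge0.
move/eqP; rewrite paddr_eq0// mulf_eq0 (gt_eqF m0) orbF.
by move=> /andP[/eqP-> /eqP/f0->]; rewrite scale0r addr0.
Qed.

(** For [x < -1] both [x] and [x + 1] are negative, so all the generators of the
    cone have the sign of [(-1)^d] at [x]. *)
Lemma hpos_ltN1 d f (x : R) : hpos d f -> f != 0 -> x < -1 -> f.[x] != 0.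
Proof.
move=> hf f0 x1; suff: 0 <= (-1) ^+ d * f.[x] /\ (f.[x] = 0 -> f = 0).
  by move=> [_ f0']; apply: contra_neq f0.
elim: hf => {f f0} [|a i f a0 id _ [fx f0]]; first by rewrite horner0 mulr0.
have m0 : 0 < (-1) ^+ d * ('X ^+ i * ('X + 1) ^+ (d - i)).[x].
  rewrite -{1}(subnKC id) exprD hornerM !horner_exp hornerD hornerX hornerC.
  rewrite mulrACA -!exprMn.
  by rewrite mulr_gt0// exprn_gt0// mulN1r; lra.
have am : 0 <= a * ((-1) ^+ d * ('X ^+ i * ('X + 1) ^+ (d - i)).[x]).
  by rewrite mulr_ge0// ltW.
rewrite hornerD hornerZ mulrDr [X in 0 <= X + _]mulrCA.
split=> [|s0]; first by rewrite addr_ge0.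
have /eqP := congr1 ( *%R ((-1) ^+ d)) s0.
rewrite /= mulr0 mulrDr [X in X + _]mulrCA paddr_eq0// mulf_eq0.
rewrite (gt_eqF m0) orbF mulf_eq0 signr_eq0/=.
by move=> /andP[/eqP-> /eqP/f0->]; rewrite scale0r addr0.
Qed.

End NonnegativeH.

(** * Stability and interlacing in the upper half plane *)

Section UpperHalfPlane.
Variable R : rcfType.
Local Notation C := R[i].
Local Open Scope complex_scope.
Local Notation Re := (@complex.Re R).
Local Notation Im := (@complex.Im R).
Local Notation "z ^*" := (@conjc R z) : ring_scope.
Local Notation "z ^*" := (@conjc R z) : complex_scope.
Implicit Types (f g : {poly R}) (h : {poly C}) (z w : C).

Definition ev f z : C := (map_poly (real_complex R) f).[z].

Lemma evD f g z : ev (f + g) z = ev f z + ev g z.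
Proof. by rewrite /ev rmorphD hornerD. Qed.

Lemma evB f g z : ev (f - g) z = ev f z - ev g z.
Proof. by rewrite /ev rmorphB hornerD hornerN. Qed.

Lemma evM f g z : ev (f * g) z = ev f z * ev g z.
Proof. by rewrite /ev rmorphM hornerM. Qed.

Lemma evMn f n z : ev (f *+ n) z = ev f z *+ n.
Proof. by rewrite /ev rmorphMn hornerMn. Qed.

Lemma ev_sum (I : Type) (s : seq I) (P : pred I) (F : I -> {poly R}) z :
  ev (\sum_(i <- s | P i) F i) z = \sum_(i <- s | P i) ev (F i) z.
Proof. by rewrite /ev rmorph_sum horner_sum. Qed.

Lemma evX z : ev 'X z = z.
Proof. by rewrite /ev map_polyX hornerX. Qed.

Lemma ev1 z : ev 1 z = 1.
Proof. by rewrite /ev rmorph1 hornerC. Qed.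

Lemma evX1 z : ev ('X + 1) z = z + 1.
Proof. by rewrite evD evX ev1. Qed.

Lemma ev_real f (x : R) : ev f x%:C = (f.[x])%:C.
Proof. exact: horner_map. Qed.

Lemma ev_conj f z : ev f z^* = (ev f z)^*.
Proof.
rewrite /ev -(horner_map conjc) /= -map_poly_comp /=; congr (_.[_]).
by apply: eq_map_poly => x /=; rewrite oppr0.
Qed.

Lemma ImD z w : Im (z + w) = Im z + Im w.
Proof. by case: z w => a b [c d]. Qed.

Lemma ImB z w : Im (z - w) = Im z - Im w.
Proof. by case: z w => a b [c d]. Qed.

Lemma ImN z : Im (- z) = - Im z.
Proof. by case: z. Qed.

Lemma Im_sum (I : Type) (s : seq I) (P : pred I) (F : I -> C) :
  Im (\sum_(i <- s | P i) F i) = \sum_(i <- s | P i) Im (F i).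
Proof. by apply: (big_morph Im) => //; apply: ImD. Qed.

Lemma Im_muln z n : Im (z *+ n) = Im z *+ n.
Proof. by elim: n => // n IH; rewrite !mulrS ImD IH. Qed.

Lemma Im_inv_lt0 z : 0 < Im z -> Im z^-1 < 0.
Proof.
case: z => a b /= b0; rewrite oppr_lt0 divr_gt0//.
by rewrite ltr_wpDl ?sqr_ge0// exprn_gt0.
Qed.

Lemma Im_mul_conj z : Im (z * z^*) = 0.
Proof. by case: z => a b /=; ring. Qed.

Lemma Re_mul_conj_gt0 z : z != 0 -> 0 < Re (z * z^*).
Proof.
case: z => a b; rewrite eq_complex /= => ab.
rewrite mulrN opprK -!expr2 lt_neqAle addr_ge0 ?sqr_ge0// andbT eq_sym.
by rewrite paddr_eq0 ?sqr_ge0// !sqrf_eq0.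
Qed.

Lemma ImM_real z w : Im w = 0 -> Im (z * w) = Im z * Re w.
Proof. by case: z w => a b [c d] /= ->; ring. Qed.

Lemma deriv_prod_XsubC (s : seq C) z : z \notin s ->
  (\prod_(a <- s) ('X - a%:P))^`().[z] =
  (\prod_(a <- s) ('X - a%:P)).[z] * \sum_(a <- s) (z - a)^-1.
Proof.
elim: s => [|a s IH]; first by rewrite !big_nil derivC horner0 mulr0.
rewrite inE negb_or => /andP[za zs]; rewrite !big_cons derivM.
rewrite derivB derivX derivC subr0 mul1r hornerD !hornerM IH// !hornerE mulrDr.
by rewrite mulrAC divff ?mul1r ?mulrA// subr_eq0.
Qed.

(** The logarithmic derivative at [z] is the sum of the [1 / (z - a)] over the zeros
    [a]; these lie weakly below the real axis, so that every summand has negative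
    imaginary part. *)
Lemma Gauss_Lucas h z :
  (forall w, 0 < Im w -> ~~ root h w) -> (exists w, root h w) ->
  0 < Im z -> ~~ root h^`() z.
Proof.
move=> nroot [w hw] z0; have [s hs] := closed_field_poly_normal h.
have h0 : h != 0 by apply: contraTneq (nroot _ z0) => ->; rewrite root0.
have sP a : a \in s -> Im a <= 0.
  move=> sa; rewrite leNgt; apply/negP => /nroot /negP; apply.
  by rewrite hs rootZ ?lead_coef_eq0// root_prod_XsubC.
have zs : z \notin s by apply/negP => /sP; rewrite leNgt z0.
have := nroot _ z0; rewrite hs derivZ !rootZ ?lead_coef_eq0// !rootE.
rewrite deriv_prod_XsubC// mulf_eq0 negb_or => ->/=.
have : w \in s by move: hw; rewrite {1}hs rootZ ?lead_coef_eq0// root_prod_XsubC.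
have nega a : a \in s -> Im (z - a)^-1 < 0.
  move=> /sP sa; apply: Im_inv_lt0.
  by case: (z) z0 (a) sa => x y /= y0 [x' y'] /= y'0; lra.
case: s nega {hs sP zs} => // a s nega _.
rewrite big_cons; apply/eqP => /(congr1 Im) /eqP; apply/negP.
rewrite ImD Im_sum lt_eqF//= -[X in _ < X]addr0 ltr_leD ?nega ?mem_head//.
by rewrite big_seq sumr_le0// => b bs; rewrite ltW// nega// inE bs orbT.
Qed.

(** For real coefficients this says that all zeros are real. *)
Definition stable f := forall z, 0 < Im z -> ev f z != 0.

Lemma stable_neq0 f : stable f -> f != 0.
Proof.
move=> /(_ 'i%C ltr01); apply: contra_neq => ->.
by rewrite /ev rmorph0 horner0.
Qed.

Lemma stable_conj f z : stable f -> Im z != 0 -> ev f z != 0.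
Proof.
move=> sf; rewrite neq_lt => /orP[z0|]; last exact: sf.
rewrite -conjc_eq0 -ev_conj; apply: sf.
by case: z z0 => a b /=; rewrite oppr_gt0.
Qed.

Lemma upper_neq_real z (x : R) : 0 < Im z -> z != x%:C.
Proof. by move=> z0; apply/eqP => zx; rewrite zx /= ltxx in z0. Qed.

Lemma stable1 : stable 1.
Proof. by move=> z _; rewrite ev1 oner_neq0. Qed.

Lemma stableM f g : stable f -> stable g -> stable (f * g).
Proof. by move=> sf sg z z0; rewrite evM mulf_neq0 ?sf ?sg. Qed.

Lemma stableX : stable 'X.
Proof. by move=> z z0; rewrite evX (upper_neq_real 0). Qed.

Lemma stableX1 : stable ('X + 1).
Proof.
move=> z z0; rewrite evX1 addr_eq0.
by have := upper_neq_real (-1) z0; rewrite rmorphN1.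
Qed.

Lemma stable_mulr f g : stable (f * g) -> stable g.
Proof. by move=> sfg z /sfg; rewrite evM mulf_eq0 negb_or => /andP[]. Qed.

Lemma stable_deriv f (x : R) : stable f -> root f x -> stable f^`().
Proof.
move=> sf fx z z0; rewrite /ev -deriv_map; apply: Gauss_Lucas z0.
  by move=> w; apply: sf.
by exists x%:C; rewrite rootE [_.[_]]ev_real (rootP fx).
Qed.

Lemma stable_subdivX f : stable f -> stable (subdivX f).
Proof.
move=> sf; apply: stableM stableX _; apply: (@stable_deriv _ (-1)).
  exact: stableM stableX1 sf.
by rewrite rootE !hornerE addNr mul0r.
Qed.

Lemma stable_subdivX1 f : stable f -> stable (subdivX1 f).
Proof.
move=> sf; apply: stableM stableX1 _; apply: (@stable_deriv _ 0).
  exact: stableM stableX sf.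
by rewrite rootE !hornerE.
Qed.

Lemma stable_subdivU f : stable f -> stable (subdivU f).
Proof. by move=> /(stableM stableX)/stable_subdivX; rewrite subdivX_mulX => /stable_mulr. Qed.

Lemma stable_iter op m f :
  (forall g, stable g -> stable (op g)) -> stable f -> stable (iter m op f).
Proof. by move=> hop sf; elim: m => //= m; apply: hop. Qed.

Lemma conj_swap z w : (w * z^*)^* = z * w^*.
Proof. by case: z w => a b [c d]; congr (_ +i* _) => /=; ring. Qed.

(** [g(z) / f(z)] lies in the closed sector between the positive real axis and the
    ray through [z]. For stable polynomials with nonpositive zeros this is
    interlacing, the largest zero belonging to [g]. *)
Definition sector f g := forall z, 0 < Im z ->
  0 <= Im (ev g z * (ev f z)^*) /\ 0 <= Im (z * ev f z * (ev g z)^*).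

(** If [c = a + b z] with [a], [b] real then [Im c = b Im z] and
    [Im (z c^* ) = a Im z], so this is [Im (s c) = a Im s + b Im (s z)]. *)
Lemma Im_span z c s :
  Im z * Im (s * c) = Im (z * c^*) * Im s + Im c * Im (z * s).
Proof. by case: z c s => a b [c d] [e f] /=; ring. Qed.

Lemma Im_conj z : Im z^* = - Im z. Proof. by case: z. Qed.

Definition positive f := forall x : R, 0 < x -> 0 < f.[x].

(** The homogeneous form of the sector condition: [s g(t / s) + y f(t / s)], as a
    function of [t], has no zero in the upper half plane. If it had one, then with
    [z = t / s] the quotient [g(z) / f(z) = - y / s] would be a nonnegative
    combination of [1] and [z], so that [- y] would be one of [s] and [t]. *)
Lemma sector_nonvanishing f g s y t :
  stable f -> stable g ->
  positive f -> positive g ->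
  sector f g -> 0 < Im s -> 0 < Im y -> 0 < Im t ->
  s * ev g (t / s) + y * ev f (t / s) != 0.
Proof.
move=> sf sg pf pg fg s0 y0 t0.
have sn : s != 0 := upper_neq_real 0 s0.
set z := t / s; have tz : z * s = t by rewrite divfK.
(* The quotient of two points of the upper half plane, if real, is positive. *)
have [z0|zn] := eqVneq (Im z) 0.
  have zr : z = (Re z)%:C by case: (z) z0 => a b /= ->.
  have x0 : 0 < Re z.
    rewrite -(pmulr_lgt0 _ s0); move: t0; rewrite -tz {1}zr.
    by case: (s) => a b /=; rewrite mul0r addr0.
  apply/eqP => /(congr1 Im) /eqP; apply/negP.
  rewrite zr !ev_real ImD !ImM_real//= gt_eqF//.
  by rewrite addr_gt0// mulr_gt0// ?pf ?pg.
apply/eqP => e.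
set c := ev g z * (ev f z)^*.
have fz : ev f z != 0 by apply: stable_conj.
have e' : s * c = - (y * (ev f z * (ev f z)^*)).
  by rewrite /c; apply/eqP; rewrite -addr_eq0 !mulrA -mulrDl e mul0r.
have : Im (s * c) < 0.
  rewrite e' -mulrN ImM_real ?nmulr_llt0//.
    by case: (ev f z * _) (Re_mul_conj_gt0 fz) => a b /=; rewrite oppr_lt0.
  by rewrite -mulrN -[RHS]oppr0 -(Im_mul_conj (ev f z)); case: (ev f z) => a b /=; ring.
apply/negP; rewrite -leNgt.
have zc : z * c^* = z * ev f z * (ev g z)^*.
  by rewrite /c conj_swap mulrA.
(* If [z] lies in the lower half plane, the hypothesis is used at its conjugate. *)
move: zn; rewrite neq_lt => /orP[z0|z0].
  rewrite -(nmulr_rle0 _ z0) Im_span tz.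
  have [|c1 c2] := fg z^*; first by rewrite Im_conj oppr_gt0.
  rewrite -[X in _ <= X]addr0 lerD// mulr_le0_ge0 ?(ltW s0) ?(ltW t0)//.
    rewrite zc -oppr_ge0 -Im_conj.
    by move: c2; rewrite !ev_conj; congr (0 <= Im _);
      case: (z) (ev f z) (ev g z) => a b [a' b'] [a'' b'']; congr (_ +i* _) => /=; ring.
  rewrite -oppr_ge0 -Im_conj.
  by move: c1; rewrite !ev_conj /c; congr (0 <= Im _);
    case: (ev f z) (ev g z) => a b [a' b']; congr (_ +i* _) => /=; ring.
rewrite -(pmulr_rge0 _ z0) Im_span tz zc.
by have [c1 c2] := fg z z0; rewrite addr_ge0// mulr_ge0// ltW.
Qed.

Lemma cone_ge0 (a b : R) :
  (forall p q, 0 < p -> 0 < q -> 0 <= a * p + b * q) -> 0 <= a /\ 0 <= b.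
Proof.
suff half (c d : R) : (forall p, 0 < p -> 0 <= c * p + d) -> 0 <= c.
  move=> ab; split; apply: half => p p0.
    by have := ab p 1 p0 ltr01; rewrite mulr1; apply.
  by rewrite addrC; have := ab 1 p ltr01 p0; rewrite mulr1; apply.
move=> cd; rewrite leNgt; apply/negP => c0.
have p0 : 0 < (`|d| + 1) / - c by rewrite divr_gt0 ?oppr_gt0// ltr_wpDl.
have := cd _ p0; rewrite mulrCA invrN mulrN divff ?lt_eqF//.
have := ler_norm d; lra.
Qed.

(** Differentiation in [t] preserves the homogeneous form of the condition by
    Gauss-Lucas. If the quotient of the images left the sector at [z], a linear
    functional [c |-> Im (s c)] would be positive on [1] and [z] and negative on
    the quotient, and the derivative would vanish at [t = z s]. *)
Lemma sector_subdivX f g : stable f -> stable g -> positive f -> positive g ->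
  sector f g -> sector (subdivX f) (subdivX g).
Proof.
move=> sf sg pf pg fg z z0.
set A := ev (('X + 1) * f)^`() z; set B := ev (('X + 1) * g)^`() z.
have A0 : A != 0.
  have := stable_subdivX sf z0; rewrite /subdivX evM mulf_eq0 negb_or.
  by move=> /andP[].
have key s : 0 < Im s -> 0 < Im (z * s) -> 0 <= Im (s * (B * A^*)).
  move=> s0 zs0; rewrite leNgt; apply/negP => neg.
  have sn : s != 0 := upper_neq_real 0 s0.
  (* This [y] makes the derivative of [h] below vanish at [z s]. *)
  pose y := - (s * B / A).
  have y0 : 0 < Im y.
    have [] := (Re_mul_conj_gt0 A0, Im_mul_conj A); move: neg.
    have -> : s * (B * A^*) = - y * (A * A^*) by rewrite /y; field.
    move=> neg AA0 AI0; rewrite ImM_real// in neg.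
    by move: neg; rewrite pmulr_llt0// ImN oppr_lt0.
  pose F := map_poly (real_complex R) (('X + 1) * f).
  pose G := map_poly (real_complex R) (('X + 1) * g).
  pose h := s *: (G \Po (s^-1 *: 'X)) + y *: (F \Po (s^-1 *: 'X)).
  have hE t : h.[t] = (t / s + 1) * (s * ev g (t / s) + y * ev f (t / s)).
    rewrite /h hornerD !hornerZ !horner_comp !hornerZ !hornerX [s^-1 * t]mulrC.
    rewrite -[G.[_]]/(ev _ _) -[F.[_]]/(ev _ _) !evM !evX1; ring.
  have : ~~ root h^`() (z * s).
    apply: Gauss_Lucas zs0 => [t t0|].
      rewrite rootE hE mulf_neq0 ?sector_nonvanishing// addr_eq0.
      apply/eqP => /(congr1 ( *%R^~ s)); rewrite divfK// mulN1r => ts.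
      by move: t0; rewrite ts ImN oppr_gt0 ltNge (ltW s0).
    by exists (- s); rewrite rootE hE mulNr divff// addNr mul0r.
  rewrite rootE /h derivD !derivZ !deriv_comp derivZ derivX.
  rewrite hornerD !hornerZ !hornerM !horner_comp !hornerZ !hornerX hornerC.
  rewrite [s^-1 * (z * s)]mulrC mulfK// !deriv_map.
  rewrite -[(map_poly _ _).[_]]/(ev _ _) -/B -[(map_poly _ _).[_]]/(ev _ _) -/A.
  by apply/negP/negPn/eqP; rewrite /y; field; rewrite A0 sn.
have [c1 c2] : 0 <= Im (z * (B * A^*)^*) /\ 0 <= Im (B * A^*).
  (* As [z] is not real, [Im s] and [Im (z s)] can be prescribed. *)
  apply: cone_ge0 => p q p0 q0; pose s : C := ((q - p * Re z) / Im z) +i* p.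
  have zs : Im (z * s) = q.
    by rewrite /s; case: (z) z0 => a b /= b0; field; rewrite gt_eqF.
  have := key s p0; rewrite zs => /(_ q0); rewrite -(pmulr_rge0 _ z0).
  by rewrite Im_span zs.
have zz := Re_mul_conj_gt0 (upper_neq_real 0 z0).
rewrite /subdivX !evM !evX -/A -/B.
have -> : z * B * (z * A)^* = B * A^* * (z * z^*) by rewrite rmorphM /=; ring.
have -> : z * (z * A) * (z * B)^* = z * (B * A^*)^* * (z * z^*).
  by rewrite conj_swap rmorphM /=; ring.
by rewrite ![Im (_ * (z * z^*))]ImM_real ?Im_mul_conj// !pmulr_lge0.
Qed.

Lemma sector_iter_subdivX m d e f g : stable f -> stable g -> hpos d f -> hpos e g ->
  sector f g -> sector (iter m subdivX f) (iter m subdivX g).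
Proof.
move=> sf sg hf hg fg; have sV k p : stable p -> stable (iter k subdivX p).
  exact: stable_iter stable_subdivX.
have pV n p : hpos n p -> stable p -> forall k, positive (iter k subdivX p).
  move=> he se k x; apply: (hpos_gt0 (hpos_iter k (@hpos_subdivX R) he)).
  by apply: stable_neq0; apply: sV.
by elim: m => //= m IH; apply: sector_subdivX IH; [apply: sV|apply: sV|apply: pV hf _ _|apply: pV hg _ _].
Qed.

End UpperHalfPlane.

(** * Real-rootedness of the two kinds of generating functions *)

Section TruncationPolynomials.
Variable R : rcfType.
Local Notation surj_poly := (surj_poly R).
Local Notation trunc_poly := (trunc_poly R).
Local Notation trunc_prod_poly := (trunc_prod_poly R).
Local Notation C := R[i].
Local Open Scope complex_scope.
Local Notation Re := (@complex.Re R).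
Local Notation Im := (@complex.Im R).
Local Notation "z ^*" := (@conjc R z) : ring_scope.
Local Notation "z ^*" := (@conjc R z) : complex_scope.
Implicit Types (f g : {poly R}) (z w : C).

Lemma stable_hpos_root d f w : stable f -> hpos d f ->
  root (map_poly (real_complex R) f) w -> w = (Re w)%:C /\ -1 <= Re w <= 0.
Proof.
move=> sf hf fw; have w0 : Im w = 0.
  by apply/eqP; apply: contraTT fw => /(stable_conj sf).
case: w w0 fw => a b /= ->; rewrite rootE [_.[_]](ev_real f a) => /eqP[fa].
have f0 := stable_neq0 sf; split=> //.
apply/andP; split; rewrite leNgt; apply/negP => x.
  by have /eqP := hpos_ltN1 hf f0 x.
by have := hpos_gt0 hf f0 x; rewrite fa ltxx.
Qed.

(** [t ((1 + t) f)' / (t f)] equals [1 + sum_a (1 + z) / (z - a)] at [z], and each summand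
    is [1 + (1 + a) / (z - a)], of nonpositive imaginary part because [a >= -1]. The
    zero [a = 0] makes the inequality strict. *)
Lemma subdivX_strict d f z : stable f -> hpos d f -> root f 0 -> 0 < Im z ->
  0 < Im (z * ev f z * (ev (subdivX f) z)^*).
Proof.
move=> sf hf f0 z0; have [s hs] := closed_field_poly_normal (map_poly (real_complex R) f).
have lc : lead_coef (map_poly (real_complex R) f) != 0.
  by rewrite lead_coef_eq0 map_poly_eq0 stable_neq0.
have memP w : w \in s -> w = (Re w)%:C /\ -1 <= Re w <= 0.
  by move=> ws; apply: (stable_hpos_root sf hf); rewrite hs rootZ// root_prod_XsubC.
have zs : z \notin s.
  by apply/negP => /memP[ze _]; have := upper_neq_real (Re z) z0; rewrite -ze eqxx.
have s0 : 0 \in s.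
  rewrite -root_prod_XsubC -(rootZ _ _ lc) -hs.
  by rewrite rootE [_.[_]](ev_real f 0) (rootP f0).
have dE : ev f^`() z = ev f z * \sum_(a <- s) (z - a)^-1.
  by rewrite /ev -deriv_map hs derivZ !hornerZ deriv_prod_XsubC// mulrA.
pose q := 1 + \sum_(a <- s) (z + 1) / (z - a).
have VE : ev (subdivX f) z = z * ev f z * q.
  rewrite /subdivX derivM derivD derivX derivC addr0 mul1r evM evD evM evX evX1 dE /q.
  by rewrite -mulr_sumr; ring.
have -> : z * ev f z * (ev (subdivX f) z)^* = q^* * ((z * ev f z) * (z * ev f z)^*).
  by rewrite VE [(_ * q)^*]rmorphM /=; ring.
rewrite ImM_real ?Im_mul_conj// pmulr_lgt0; last first.
  by apply: Re_mul_conj_gt0; rewrite mulf_neq0 ?sf// (upper_neq_real 0 z0).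
rewrite Im_conj oppr_gt0 /q ImD /= add0r Im_sum (big_rem 0)//=.
have termE a : a \in s -> Im ((z + 1) / (z - a)) = Im (z - a)^-1 * (1 + Re a).
  move=> sa; have za : z - a != 0 by rewrite subr_eq0; apply: contraNneq zs => ->.
  have -> : (z + 1) / (z - a) = 1 + (z - a)^-1 * (1 + a) by field.
  have [ar _] := memP a sa.
  by rewrite ImD ImM_real; rewrite ar//= ?addr0 ?add0r.
have inv_lt0 a : a \in s -> Im (z - a)^-1 < 0.
  by move=> /memP[ar _]; apply: Im_inv_lt0; rewrite ImB ar /= subr0.
rewrite -[X in _ < X]addr0 ltr_leD//.
  by rewrite termE//= addr0 mulr1 inv_lt0.
rewrite big_seq sumr_le0// => a /mem_rem sa.
by rewrite termE// mulr_le0_ge0 ?(ltW (inv_lt0 _ sa))//; have [_] := memP a sa; lra.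
Qed.

Lemma hpos_surj_poly k : hpos k (surj_poly k).
Proof. by rewrite -[X in hpos X _]addn0; apply: hpos_iter (hpos_one R) => *; apply: hpos_subdivX. Qed.

Lemma stable_surj_poly k : stable (surj_poly k).
Proof. by apply: stable_iter (@stable_subdivX R) (@stable1 R). Qed.

Lemma hpos_trunc_poly k : hpos k (trunc_poly k).
Proof. by rewrite -[X in hpos X _]addn0; apply: hpos_trunc_diff (hpos_one R). Qed.

(* The transport of [x^s (x + 1)^(k - s)]. *)
Let part k s : {poly R} := iter s subdivX (iter (k - s) subdivX1 1).

Let trunc_polyE k : trunc_poly k = \sum_(s < k.+1) part k s *+ s.+1.
Proof. exact: trunc_diffE. Qed.

(* Both sides are images under [subdivX^s]; before that, they are [1 + t] and [t] times
   the same polynomial, and [t / (1 + t)] is in the sector. *)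
Let sector_part k s : (s <= k)%N -> sector (part k s) (surj_poly k).
Proof.
move=> sk; rewrite /surj_poly -[X in iter X subdivX 1](subnKC sk) iterD /part.
have sW r : stable (iter r subdivX1 1 : {poly R}).
  exact: stable_iter (@stable_subdivX1 R) (@stable1 R).
have hW r : hpos r (iter r subdivX1 1 : {poly R}).
  by rewrite -[X in hpos X _]addn0; apply: hpos_iter (hpos_one R) => *; apply: hpos_subdivX1.
apply: (@sector_iter_subdivX R s (k - s)); rewrite ?sW ?hW//.
- exact: stable_surj_poly.
- exact: hpos_surj_poly.
case: (k - s)%N => [|r] z z0.
  by rewrite /= !ev1 conjc1 !mulr1 (ltW z0).
rewrite iterS_subdivX_1 iterS_subdivX1_1 !evM evX evX1; set u := ev _ z.
have -> : z * u * ((z + 1) * u)^* = z * (z + 1)^* * (u * u^*).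
  by rewrite rmorphM /=; ring.
have -> : z * ((z + 1) * u) * (z * u)^* = (z + 1) * (z * z^*) * (u * u^*).
  by rewrite rmorphM /=; ring.
have u0 : 0 <= Re (u * u^*).
  by case: (u) => a b /=; rewrite mulrN opprK -!expr2 addr_ge0 ?sqr_ge0.
rewrite ![Im (_ * (u * _))]ImM_real ?Im_mul_conj// [Im (_ * (z * _))]ImM_real ?Im_mul_conj//.
have zz0 := Re_mul_conj_gt0 (upper_neq_real 0 z0).
rewrite !mulr_ge0 ?(ltW zz0)//; first by case: (z) z0 => a b /=; lra.
by case: (z) z0 => a b /=; lra.
Qed.

Let part_self k : part k k = surj_poly k.
Proof. by rewrite /part subnn. Qed.

(** This and [trunc_poly_cross2] express that [surj_poly k] interlaces
    [t * trunc_poly k]; both are obtained term by term from [sector_part]. *)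
Lemma trunc_poly_cross1 k z : 0 < Im z ->
  0 <= Im (ev (surj_poly k) z * (ev (trunc_poly k) z)^*).
Proof.
move=> z0; rewrite trunc_polyE ev_sum rmorph_sum mulr_sumr Im_sum sumr_ge0// => s _ /=.
rewrite evMn rmorphMn mulrnAr Im_muln mulrn_wge0//.
by have [] := sector_part (leq_ord s) z0.
Qed.

(** The summand [s = 0] of [trunc_poly] is [(1 + t) / t] times [surj_poly], which is not
    a real multiple of it. *)
Lemma trunc_poly_cross1_strict k z : 0 < Im z ->
  0 < Im (ev (surj_poly k.+1) z * (ev (trunc_poly k.+1) z)^*).
Proof.
move=> z0; rewrite trunc_polyE ev_sum rmorph_sum mulr_sumr Im_sum big_ord_recl /=.
rewrite ltr_pwDl//; last first.
  rewrite sumr_ge0// => s _; rewrite evMn rmorphMn mulrnAr Im_muln mulrn_wge0//.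
  by have [] := sector_part (leq_ord (lift ord0 s)) z0.
rewrite mulr1n (_ : part k.+1 0 = ('X + 1) * iter k subdivU 1); last first.
  by rewrite -iterS_subdivX1_1.
rewrite (_ : surj_poly k.+1 = 'X * iter k subdivU 1) ?evM ?evX ?evX1; last first.
  by rewrite -iterS_subdivX_1.
set u := ev _ z.
have u0 : u != 0 by apply: stable_iter (@stable_subdivU R) (@stable1 R) _ z0.
have -> : z * u * ((z + 1) * u)^* = z * (z + 1)^* * (u * u^*).
  by rewrite rmorphM /=; ring.
rewrite ImM_real ?Im_mul_conj// mulr_gt0 ?Re_mul_conj_gt0//.
by case: (z) z0 => a b /=; lra.
Qed.

Lemma trunc_poly_cross2 k z : 0 < Im z ->
  0 < Im (z * ev (trunc_poly k) z * (ev (surj_poly k) z)^*).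
Proof.
move=> z0; rewrite trunc_polyE ev_sum mulr_sumr mulr_suml Im_sum big_ord_recr /=.
rewrite part_self ltr_wpDl//.
  rewrite sumr_ge0// => s _; rewrite evMn mulrnAr mulrnAl Im_muln mulrn_wge0//.
  by have [] := sector_part (ltnW (ltn_ord s)) z0.
rewrite evMn mulrnAr mulrnAl Im_muln pmulrn_lgt0// -mulrA ImM_real ?Im_mul_conj//.
by rewrite mulr_gt0// Re_mul_conj_gt0// stable_surj_poly.
Qed.

Lemma stable_trunc_poly k : stable (trunc_poly k).
Proof.
move=> z z0; apply/negP => /eqP h0; have := trunc_poly_cross2 k z0.
by rewrite h0 mulr0 mul0r ltxx.
Qed.

Lemma sector_trunc_poly k : sector (surj_poly k) ('X * trunc_poly k).
Proof.
move=> z z0; rewrite evM evX; split; first by rewrite ltW// trunc_poly_cross2.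
have -> : z * ev (surj_poly k) z * (z * ev (trunc_poly k) z)^* =
          ev (surj_poly k) z * (ev (trunc_poly k) z)^* * (z * z^*).
  by rewrite rmorphM /=; ring.
rewrite ImM_real ?Im_mul_conj// mulr_ge0 ?trunc_poly_cross1// ltW//.
exact: Re_mul_conj_gt0 (upper_neq_real 0 z0).
Qed.

Lemma stable_iter_subdivU_trunc_poly m k : stable (iter m subdivU (trunc_poly k)).
Proof. exact: stable_iter (@stable_subdivU R) (@stable_trunc_poly k). Qed.

Lemma hpos_iter_subdivU_trunc_poly m k : hpos (m + k) (iter m subdivU (trunc_poly k)).
Proof. by apply: hpos_iter (hpos_trunc_poly k) => *; apply: hpos_subdivU. Qed.

(** The two subtractions are distributed so that only differences with nonnegative
    h-polynomial remain. *)
Lemma trunc_prod_polyE m k : trunc_prod_poly m k =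
  trunc_diff m ('X * trunc_poly k) +
  \sum_(s < k.+1) iter s subdivX (iter (m + k - s) subdivX1 1 - iter (m + k - s) subdivX 1) *+ s.+1.
Proof.
rewrite /trunc_prod_poly.
have -> : iter m subdivU (trunc_poly k) = iter m subdivX1 ('X * trunc_poly k) + iter m subdivX1 (trunc_poly k)
                                   - iter m subdivX ('X * trunc_poly k).
  have -> : iter m subdivX1 ('X * trunc_poly k) + iter m subdivX1 (trunc_poly k) = 
            iter m subdivX1 (('X + 1) * trunc_poly k).
    by rewrite mulrDl mul1r; apply/esym/raddfD.
  by rewrite iter_subdivX1_mulX1 iter_subdivX_mulX; ring.
suff : iter m subdivX1 (trunc_poly k) - iter m subdivX (surj_poly k) *+ 'C(k.+2, 2) =
  \sum_(s < k.+1) iter s subdivX (iter (m + k - s) subdivX1 1 - iter (m + k - s) subdivX 1) *+ s.+1.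
  by rewrite /trunc_diff => <-; ring.
(* The binomial coefficient is the sum of the multiplicities [s + 1] of [trunc_poly]. *)
rewrite -triangular_sum big_nat_recl//= add0n big_mkord -sumrMnr trunc_polyE raddf_sum.
rewrite -sumrB; apply: eq_bigr => -[s /= sk] _.
rewrite raddfMn -mulrnBl /= linearB /=; congr ((_ - _) *+ _).
  have comm j f : iter m subdivX1 (iter j subdivX f) = iter j subdivX (iter m subdivX1 f).
    by elim: m => //= n ->; rewrite iter_subdivX_X1C.
  by rewrite /part comm -iterD addnBA.
by rewrite /surj_poly -!iterD subnKC// (leq_trans _ (leq_addl m k)).
Qed.

Lemma hpos_trunc_prod_poly m k : (0 < m + k)%N -> hpos (m + k).-1 (trunc_prod_poly m k).
Proof.
move=> mk; rewrite trunc_prod_polyE; apply: hpos_add.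
  case: m mk => [|[|m]] _.
  - by rewrite trunc_diff0; apply: hpos0.
  - by rewrite trunc_diff1; apply: hpos0.
  rewrite addSnnS; have := hpos_trunc_diff m (hpos_mulX (hpos_trunc_poly k)).
  by rewrite !addSn addnS.
apply: hpos_sum => -[s /= sk] _; apply: hpos_muln.
move def_n: (m + k - s)%N => [|n].
  by rewrite /= subrr linear0; apply: hpos0.
have -> : ((m + k).-1 = s + (n + 0))%N by lia.
by apply: hpos_iter => [*|]; [apply: hpos_subdivX | apply/hpos_iter_sub/hpos_one].
Qed.

(** For [m > 0], a zero [z] gives [g(z) = z (m f(z) + c e(z))] with
    [g = subdivX f], [f] and [e] being the generating functions of the two kinds of
    coatoms. Multiplying by the conjugate of [g(z)] makes the left-hand side real,
    but both terms on the right have nonnegative imaginary part, the first one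
    positive. For [m = 0] the first kind is absent and strictness comes from
    [trunc_poly_cross1_strict]. *)
Lemma stable_trunc_prod_poly m k : (0 < m + k)%N -> stable (trunc_prod_poly m k).
Proof.
case: m => [|m mk] /=.
  case: k => // k _ z z0; apply/negP => /eqP.
  rewrite /trunc_prod_poly /= mulr0n subr0 evB evMn => /eqP; rewrite subr_eq0 => /eqP hE.
  have := trunc_poly_cross1_strict k z0; rewrite hE rmorphMn mulrnAr /= Im_muln.
  by rewrite Im_mul_conj mul0rn ltxx.
set f := 'X * trunc_poly k.
have sf : stable f by apply: stableM (@stableX R) (@stable_trunc_poly k).
have hf : hpos k.+1 f by apply: hpos_mulX; apply: hpos_trunc_poly.
have sV j : stable (iter j subdivX f) by apply: stable_iter (@stable_subdivX R) sf.
have hV j : hpos (j + k.+1) (iter j subdivX f).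
  by apply: hpos_iter hf => *; apply: hpos_subdivX.
have V0 j : root (iter j subdivX f) 0 by rewrite iter_subdivX_mulX rootE hornerM hornerX mul0r.
suff : stable ('X * trunc_prod_poly m.+1 k) by apply: stable_mulr.
have -> : 'X * trunc_prod_poly m.+1 k = subdivX (iter m subdivX f) - ('X * iter m subdivX f) *+ m.+1
    - ('X * iter m.+1 subdivX (surj_poly k)) *+ 'C(k.+2, 2).
  by rewrite /trunc_prod_poly 2!mulrBr -iter_subdivX_mulX -!mulrnAr.
move=> z z0; apply/negP; rewrite !evB !evMn (evM 'X (iter m subdivX f)) (evM 'X (iter m.+1 _ _)) evX.
rewrite -addrA -opprD subr_eq0 => /eqP gE.
have c1 := subdivX_strict (sV m) (hV m) (V0 m) z0.
have [_ c2] := sector_iter_subdivX m.+1 (@stable_surj_poly k) sf (hpos_surj_poly k) hf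
  (@sector_trunc_poly k) z0.
have := Im_mul_conj (ev (subdivX (iter m subdivX f)) z).
rewrite {1}gE mulrDl ImD !mulrnAl !Im_muln => /eqP; apply/negP.
by rewrite gt_eqF// ltr_pwDl ?mulrn_wge0// pmulrn_lgt0.
Qed.

End TruncationPolynomials.

Lemma splits_in_unit_interval (R : rcfType) d j (f p : {poly R}) :
  stable f -> hpos d f -> p = ('X + 1) ^+ j * f ->
  (forall z, root (map_poly (real_complex R) p) z -> complex.Im z = 0) /\
  (forall x, root p x -> -1 <= x <= 0).
Proof.
move=> sf hf ->; split=> [z|x].
  rewrite rmorphM rmorphXn rmorphD rmorph1 /= map_polyX rootM => /orP[|/(stable_hpos_root sf hf)].
    by rewrite rootE !hornerE expf_eq0 addr_eq0 => /andP[_ /eqP->] /=; rewrite oppr0.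
  by move=> [-> _].
rewrite rootM => /orP[|fx].
  by rewrite rootE !hornerE expf_eq0 addr_eq0 => /andP[_ /eqP->]; rewrite lexx lerN10.
have [|_] := @stable_hpos_root _ d f (real_complex R x) sf hf; last by [].
by rewrite rootE [_.[_]](ev_real f x) (rootP fx).
Qed.

(** * Chain polynomials from chain-counting weights *)

Section ChainGeneratingFunction.
Context {d : Order.disp_t} (P : finPOrderType d) (R : comNzRingType).
Implicit Types (C D : {set P}) (x y : P).
Local Open Scope order_scope.

Lemma chain_poly_sum :
  chain_poly P R = (\sum_(C : {set P} | is_chain C) 'X ^+ #|C|)%R.
Proof.
rewrite /chain_poly poly_def (partition_big (fun C : {set P} => inord #|C| : 'I_#|P|.+1) xpredT)//=.
apply: eq_bigr => k _; rewrite (eq_bigr (fun=> 'X^k)%R); last first.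
  by move=> C /andP[_ /eqP <-]; rewrite inordK// ltnS max_card.
rewrite sumr_const /nb_chains scaler_nat; congr (_ *+ _)%R.
apply: eq_card => C; rewrite !inE /=; congr (_ && _).
by rewrite -val_eqE /= inordK// ltnS max_card.
Qed.

(** [w x] counts the chains with largest element [x]. The induction removes a maximal
    element [m]: the chains through [m] are the chains strictly below [m] with [m]
    added. *)
Lemma chains_of_downset (w : P -> {poly R}) D :
  (forall x, w x = 'X * (1 + \sum_(y : P | (y < x)%O) w y))%R ->
  (forall x y : P, x \in D -> y <= x -> y \in D) ->
  (\sum_(C : {set P} | is_chain C && (C \subset D)) 'X ^+ #|C| =
   1 + \sum_(x in D) w x)%R.
Proof.
move=> wE; have [n] := ubnP #|D|; elim: n D => // n IH D Dn down.
have [->|[x0 x0D]] := set_0Vmem D.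
  rewrite big_set0 addr0 (big_pred1 set0) ?cards0// => C.
  rewrite subset0; apply/andb_idl => /eqP ->.
  by apply/forall_inP => x; rewrite inE.
have [m mD mmax] : exists2 m, m \in D & forall y : P, y \in D -> ~~ (m < y).
  case: (@arg_maxnP _ x0 (mem D) (fun x : P => #|[set y : P | y <= x]|) x0D) => m mD mmax.
  exists m => // y /mmax le_ym; apply: contraL le_ym => my; rewrite -ltnNge.
  apply: proper_card; apply/properP; split.
    by apply/subsetP => z; rewrite !inE => /le_trans; apply; apply: ltW.
  by exists y; rewrite !inE ?lexx// lt_geF.
rewrite (big_setD1 m mD)/= addrCA -IH; first last.
- move=> x y /setD1P[xm xD] yx; rewrite !inE (down x)// andbT.
  by apply: contraNneq (mmax x xD) => ym; rewrite lt_neqAle eq_sym xm -ym.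
- by rewrite (cardsD1 m D) mD ltnS in Dn.
rewrite (bigID (fun C : {set P} => m \in C))/=; congr (_ + _)%R; last first.
  by apply: eq_bigl => C; rewrite subsetD1 andbA.
rewrite wE (_ : \sum_(y | _) w y = \sum_(y in [set y : P | (y < m)%O]) w y)%R; last first.
  by apply: eq_bigl => y; rewrite inE.
rewrite -IH; first last.
- by move=> x y; rewrite !inE => xm /le_lt_trans; apply.
- rewrite (cardsD1 m D) mD ltnS in Dn; apply: leq_ltn_trans Dn.
  apply/subset_leq_card/subsetP => y; rewrite !inE => ym.
  by rewrite (lt_eqF ym) (down m)// ltW.
rewrite big_distrr /= (reindex_onto (fun C => m |: C) (fun C => C :\ m)) /=; last first.
  by move=> C /andP[_ mC]; rewrite setD1K.
apply: eq_big => [C|C /andP[_ /eqP mC]]; last first.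
  have mnC : m \notin C by rewrite -mC setD11.
  by rewrite cardsU1 mnC exprS.
have -> : ((m |: C) :\ m == C) = (m \notin C).
  by apply/eqP/idP => [<-|/setU1K//]; rewrite setD11.
rewrite setU11 andbT subUset sub1set mD /=.
apply/idP/idP => [/andP[/andP[mCch CD] mC]|/andP[Cch Cm]].
  apply/andP; split.
    apply/forall_inP => x xC; apply/forall_inP => y yC.
    by move/forall_inP: mCch => /(_ _ (setU1r m xC))/forall_inP/(_ _ (setU1r m yC)).
  apply/subsetP => y yC; rewrite inE.
  move/forall_inP: mCch => /(_ _ (setU1r m yC))/forall_inP/(_ _ (setU11 m C)).
  rewrite comparable_sym => /orP[|].
    by rewrite le_eqVlt (negPf (mmax _ (subsetP CD _ yC))) orbF => /eqP my; rewrite my yC in mC.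
  by rewrite le_eqVlt => /orP[/eqP my|//]; rewrite -my yC in mC.
rewrite -andbA; apply/and3P; split.
- apply/forall_inP => x /setU1P xC; apply/forall_inP => y /setU1P yC.
  have lt_m z : z \in C -> z < m by move=> /(subsetP Cm); rewrite inE.
  case: xC yC => [->|xC] [->|yC].
  + exact: comparablexx.
  + by rewrite comparable_sym lt_comparable// lt_m.
  + by rewrite lt_comparable// lt_m.
  + by move/forall_inP: Cch => /(_ _ xC) /forall_inP /(_ _ yC).
- apply: subset_trans Cm _; apply/subsetP => y; rewrite inE => ym.
  by apply: down mD _; apply: ltW.
- by apply/negP => /(subsetP Cm); rewrite inE ltxx.
Qed.

(** [f x] counts the chains from [b] to [x] by number of steps. Leaving out or keeping
    [b] and [t] in a chain accounts for the factor [(1 + t)^2]. *)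
Lemma chain_poly_bounded (b t : P) (f : P -> {poly R}) :
  (forall x, b <= x) -> (forall x, x <= t) -> b != t -> f b = 1%R ->
  (forall x, x != b -> x != t -> f x = 'X * \sum_(y : P | (y < x)%O) f y)%R ->
  (chain_poly P R = ('X + 1) ^+ 2 * \sum_(x | x != t) f x)%R.
Proof.
move=> bP tP bt fb fE; set r := (\sum_(x | _) f x)%R.
(* [f' t] is what the recursion of [f] would give at the top, and [w] counts the
   chains with a given largest element. *)
pose f' x : {poly R} := (if x == t then 'X * r else f x)%R.
pose w x : {poly R} := (('X + 1) * f' x - (x == b)%:R)%R.
have f'E x : x != b -> (f' x = 'X * \sum_(y : P | (y < x)%O) f' y)%R.
  move=> xb; rewrite {1}/f'; have [->|xt] := eqVneq x t.
    congr (_ * _)%R; apply: eq_big => y; first by rewrite lt_neqAle tP andbT.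
    by rewrite /f' => /negPf->.
  rewrite fE//; congr (_ * _)%R; apply: eq_bigr => y yx.
  by rewrite /f' lt_eqF// (lt_le_trans yx).
have w_sum (Q : pred P) : Q b ->
  (1 + \sum_(x | Q x) w x = ('X + 1) * \sum_(x | Q x) f' x)%R.
  move=> Qb; rewrite sumrB -mulr_sumr [X in (_ - X)%R](bigD1 b Qb)/= eqxx [X in (_ - (_ + X))%R]big1.
    by rewrite addr0 addrC subrK.
  by move=> x /andP[_ /negPf->].
rewrite chain_poly_sum; have := @chains_of_downset w setT.
rewrite (eq_bigl (@is_chain _ P)) => [->//|C]; last by rewrite subsetT andbT.
  rewrite (eq_bigl xpredT) => [|x]; last by rewrite inE.
  rewrite w_sum// (bigD1 t)//= {1}/f' eqxx.
  rewrite (eq_bigr f) => [|x /negPf xt]; last by rewrite /f' xt.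
  by rewrite -/r; ring.
move=> x; have [->|xb] := eqVneq x b.
  rewrite big_pred0 => [|y]; last by rewrite le_gtF.
  by rewrite /w /f' (negPf bt) eqxx fb /=; ring.
rewrite w_sum ?lt_neqAle 1?eq_sym ?xb ?bP//.
by rewrite /w (negPf xb) f'E//=; ring.
Qed.

End ChainGeneratingFunction.

(** * Weights on families of subsets *)

Section SubsetFamilies.
Context {d : Order.disp_t} (P : finPOrderType d) (R : comNzRingType) (G : finType).
Implicit Types (F : {set {set G}}) (S T : {set G}).

Lemma chain_poly_family F (phi : P -> {set G}) (wt : {set G} -> {poly R}) :
  (forall x y : P, (x <= y)%O = (phi x \subset phi y)) ->
  (forall S, reflect (exists x, phi x = S) (S \in F)) ->
  set0 \in F -> setT \in F -> set0 != setT :> {set G} -> wt set0 = 1 ->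
  (forall S, S \in F -> S != set0 -> S != setT ->
     wt S = 'X * \sum_(T in F | T \proper S) wt T) ->
  chain_poly P R = ('X + 1) ^+ 2 * \sum_(S in F | S != setT) wt S.
Proof.
move=> phi_le phiF F0 FT F0T wt0 wtE.
have phi_inj : injective phi.
  by move=> x y xy; apply/le_anti; rewrite !phi_le xy subxx.
have phi_lt x y : (x < y)%O = (phi x \proper phi y).
  by rewrite lt_neqAle phi_le properEneq (inj_eq phi_inj).
have sumE (Q : pred {set G}) : \sum_(S in F | Q S) wt S = \sum_(x | Q (phi x)) wt (phi x).
  have -> : F = phi @: setT.
    apply/setP => S; apply/phiF/imsetP => [[x <-]|[x _ ->]]; last by exists x.
    by exists x.
  rewrite big_imset_cond/=; last by move=> x y _ _ /phi_inj.
  by apply: eq_bigl => x; rewrite inE.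
have /phiF[b bE] := F0; have /phiF[t tE] := FT.
rewrite (@chain_poly_bounded _ P R b t (wt \o phi)) /=.
- congr (_ * _); rewrite sumE; apply: eq_bigl => x.
  by rewrite -tE (inj_eq phi_inj).
- by move=> x; rewrite phi_le bE sub0set.
- by move=> x; rewrite phi_le tE subsetT.
- by rewrite -(inj_eq phi_inj) bE tE.
- by rewrite bE.
move=> x xb xt; rewrite wtE.
- by rewrite sumE; congr (_ * _); apply: eq_bigl => y; rewrite phi_lt.
- by apply/phiF; exists x.
- by rewrite -bE (inj_eq phi_inj).
- by rewrite -tE (inj_eq phi_inj).
Qed.

End SubsetFamilies.

Section SubsetSums.
Variables (R : comNzRingType) (G : finType).
Implicit Types (S T B C : {set G}) (u : {set G} -> {poly R}).

Lemma big_subsetU1 S x u : x \notin S ->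
  \sum_(T : {set G} | T \subset x |: S) u T =
  \sum_(T : {set G} | T \subset S) u T + \sum_(T : {set G} | T \subset S) u (x |: T).
Proof.
move=> xS; rewrite (bigID (fun T : {set G} => x \in T))/= addrC; congr (_ + _).
  by apply: eq_bigl => T; rewrite -subsetD1 setU1K.
rewrite (reindex_onto (fun T => x |: T) (fun T => T :\ x)) /=; last first.
  by move=> T /andP[_ xT]; rewrite setD1K.
apply: eq_bigl => T; rewrite setU11 andbT.
apply/andP/idP => [[xTS /eqP <-]|TS].
  by rewrite subDset.
have xT : x \notin T by apply: contra xS; apply: (subsetP TS).
by rewrite setUS// setU1K.
Qed.

(** Each element outside [C] either stays out of the subset or enters it; together the
    two choices act as [1 + subdivX = subdivX1]. *)
Lemma sum_subsets_subdivX1 C S u : C \subset S ->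
  (forall x T, x \notin C -> x \notin T -> u (x |: T) = subdivX (u T)) ->
  \sum_(T : {set G} | T \subset S) u T =
  iter #|S :\: C| subdivX1 (\sum_(T : {set G} | T \subset C) u T).
Proof.
move=> CS uE; have [n] := ubnP #|S :\: C|; elim: n S CS => // n IH S CS Sn.
have [SC|[x]] := set_0Vmem (S :\: C).
  suff -> : S = C by rewrite setDv cards0.
  by apply/eqP; rewrite eqEsubset CS -setD_eq0 SC eqxx.
rewrite inE => /andP[xC xS].
have card_S : #|S :\: C| = #|(S :\ x) :\: C|.+1.
  rewrite (cardsD1 x) !inE xC xS; congr (_.+1).
  by apply: eq_card => y; rewrite !inE andbCA.
rewrite -(setD1K xS) big_subsetU1 ?setD11// setD1K// card_S /= -IH.
- rewrite subdivX1E addrC raddf_sum; congr (_ + _); apply: eq_bigr => T TS.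
  by rewrite uE//; apply/negP => /(subsetP TS); rewrite setD11.
- by rewrite subsetD1 CS.
- by rewrite card_S ltnS in Sn.
Qed.

Lemma sum_card_const S (Q : pred {set G}) (p : {poly R}) (j : nat) :
  (forall T, Q T = (T \subset S) && (#|T| == j)) ->
  \sum_(T | Q T) p = p *+ 'C(#|S|, j).
Proof.
move=> QE; rewrite sumr_const -cards_draws; congr (_ *+ _).
by apply: eq_card => T; rewrite inE -[T \in _]/(Q T) QE.
Qed.

Lemma sum_surj_poly S : \sum_(T : {set G} | T \subset S) surj_poly R #|T| = iter #|S| subdivX1 1.
Proof.
rewrite (@sum_subsets_subdivX1 set0) ?sub0set// ?setD0.
  by rewrite (big_pred1 set0) ?cards0// => T; rewrite subset0.
by move=> x T _ xT; rewrite cardsU1 xT.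
Qed.

Lemma surj_poly_rec S : S != set0 ->
  surj_poly R #|S| = 'X * \sum_(T : {set G} | T \proper S) surj_poly R #|T|.
Proof.
move=> S0; have := sum_surj_poly S; rewrite (bigD1 S)//= => /(canRL (addKr _)).
rewrite (eq_bigl (fun T : {set G} => T \proper S)) => [->|T]; last first.
  by rewrite properEneq andbC.
have /prednK <- : (0 < #|S|)%N by rewrite card_gt0.
by rewrite /surj_poly iterS_subdivX_1 iterS_subdivX1_1; ring.
Qed.

End SubsetSums.

Section CircuitFamilies.
Variables (R : comNzRingType) (G : finType) (C : {set G}) (k : nat).
Hypothesis cardC : #|C| = k.+2.
Implicit Types S T : {set G}.

(** The flats of the matroid on [G] whose only circuit is [C]. *)
Definition circuit_flats : {set {set G}} := [set S | #|C :\: S| != 1%N].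

(** The generating function, by number of steps, of the chains of flats from the empty
    set to [S]: below a flat not containing [C] all subsets are flats. *)
Definition circuit_wt S : {poly R} :=
  if C \subset S then iter #|S :\: C| subdivX ('X * trunc_poly R k) else surj_poly R #|S|.

Lemma circuit_wt_below_circuit :
  \sum_(S : {set G} | (S \subset C) && (S \in circuit_flats)) circuit_wt S
  = ('X + 1) * trunc_poly R k.
Proof.
have nflatE S : (S \subset C) && (S != C) && (S \notin circuit_flats) =
    (S \subset C) && (#|S| == k.+1).
  rewrite inE negbK -andbA; apply: andb_id2l => SC.
  have := cardsD C S; rewrite (setIidPr SC) cardC => ->.
  have := subset_leq_card SC; rewrite cardC => leS.
  have [->|_] := eqVneq S C; last by lia.
  by rewrite cardC; lia.
have sum_nflat : \sum_(S : {set G} | (S \subset C) && (S != C) && (S \notin circuit_flats))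
    surj_poly R #|S| = surj_poly R k.+1 *+ k.+2.
  rewrite -[in RHS](binSn k.+1) -cardC -(sum_card_const (surj_poly R k.+1) nflatE).
  by apply: eq_bigr => S; rewrite nflatE => /andP[_ /eqP->].
have Cflat : C \in circuit_flats by rewrite inE setDv cards0.
rewrite (bigD1 C) ?subxx//= {1}/circuit_wt subxx setDv cards0 /= mulrDl mul1r.
congr (_ + _).
rewrite (eq_big (fun S => (S \subset C) && (S != C) && (S \in circuit_flats))
    (fun S => surj_poly R #|S|)).
- have := sum_surj_poly R C; rewrite (bigD1 C)//= (bigID (mem circuit_flats))/= sum_nflat.
  by rewrite cardC /trunc_poly /trunc_diff /surj_poly => <- /=; ring.
- by move=> S; rewrite andbAC.
move=> S /andP[/andP[SC _] SnC]; rewrite /circuit_wt.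
by case: ifP => // CS; case/negP: SnC; rewrite eqEsubset SC CS.
Qed.

(** The sum over all flats contained in [S] is obtained from the sum over those
    contained in [C] by applying [subdivX1] once for each further element. *)
Lemma circuit_wt_below S : C \subset S ->
  \sum_(T in circuit_flats | T \proper S) circuit_wt T
  = iter #|S :\: C| subdivU (trunc_poly R k).
Proof.
(* Extending the weight by zero makes the sum run over all subsets. *)
move=> CS; pose u T := if T \in circuit_flats then circuit_wt T else 0.
have uE x T : x \notin C -> x \notin T -> u (x |: T) = subdivX (u T).
  move=> xC xT; rewrite /u !inE.
  have -> : C :\: (x |: T) = C :\: T.
    by apply/setP => y; rewrite !inE negb_or; case: eqP => // ->; rewrite (negPf xC) !andbF.
  case: ifP => _; last by rewrite linear0.
  rewrite /circuit_wt.
  have -> : (C \subset x |: T) = (C \subset T).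
    by rewrite -[in RHS](setU1K xT) subsetD1 xC andbT.
  case: ifP => _; last by rewrite cardsU1 xT.
  have -> : #|(x |: T) :\: C| = #|T :\: C|.+1.
    rewrite (cardsD1 x) !inE eqxx xC; congr (_.+1); apply: eq_card => y.
    by rewrite !inE; case: eqP => [->|//]; rewrite (negPf xT) andbF.
  by [].
have := sum_subsets_subdivX1 CS uE.
rewrite /u -!big_mkcondr circuit_wt_below_circuit iter_subdivX1_mulX1.
have Sflat : S \in circuit_flats.
  by rewrite inE; move: CS; rewrite -setD_eq0 => /eqP->; rewrite cards0.
rewrite (bigD1 S) ?subxx//= {1}/circuit_wt CS iter_subdivX_mulX.
rewrite (eq_bigl (fun T => (T \in circuit_flats) && (T \proper S))) => [sumE|T].
  by apply: (addrI ('X * iter #|S :\: C| subdivU (trunc_poly R k))); rewrite sumE; ring.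
by rewrite andbAC andbC properEneq [(T != S) && _]andbC.
Qed.

Lemma circuit_wt_rec S : S \in circuit_flats -> S != set0 ->
  circuit_wt S = 'X * \sum_(T in circuit_flats | T \proper S) circuit_wt T.
Proof.
rewrite inE => Sflat S0; have [CS|nCS] := boolP (C \subset S).
  by rewrite circuit_wt_below// /circuit_wt CS iter_subdivX_mulX.
rewrite /circuit_wt (negPf nCS) surj_poly_rec//; congr (_ * _).
have nCT T : T \proper S -> C \subset T = false.
  by move=> /proper_sub TS; apply: contraNF nCS => /subset_trans; apply.
apply: eq_big => [T|T /nCT->//]; apply/esym/andb_idl => TS; rewrite inE.
have := subset_leq_card (setDS C (proper_sub TS)).
by have := nCS; rewrite -setD_eq0 -cards_eq0; move: Sflat; lia.
Qed.

Lemma circuit_wt0 : circuit_wt set0 = 1.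
Proof.
by rewrite /circuit_wt subset0 -cards_eq0 cardC /= cards0.
Qed.

Lemma circuit_flats0 : set0 \in circuit_flats.
Proof. by rewrite inE setD0 cardC. Qed.

Lemma circuit_flatsT : setT \in circuit_flats.
Proof. by rewrite inE setDT cards0. Qed.

(** A flat has rank one less than its cardinality if it contains [C], and rank equal to
    its cardinality otherwise; coatoms have rank [#|G| - 2]. *)
Definition circuit_coatom S := #|~: S| == (if C \subset S then 1 else 2)%N.

Definition trunc_circuit_flats : {set {set G}} :=
  [set S in circuit_flats | (S == setT) || ~~ circuit_coatom S].

(** The complement of a coatom is a point outside [C], or a pair inside [C]. *)
Lemma sum_circuit_coatoms :
  \sum_(S in circuit_flats | (S != setT) && circuit_coatom S) circuit_wt S =
  iter #|~: C|.-1 subdivX ('X * trunc_poly R k) *+ #|~: C| +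
  iter #|~: C| subdivX (surj_poly R k) *+ 'C(k.+2, 2).
Proof.
have sum_setC (p : {poly R}) (Q : pred {set G}) (B : {set G}) (j : nat) :
    (forall S, Q S = (~: S \subset B) && (#|~: S| == j)) ->
    \sum_(S | Q S) p = p *+ 'C(#|B|, j).
  move=> QE; rewrite (reindex_inj (@setC_inj G)); apply: sum_card_const => T.
  by rewrite QE setCK.
rewrite (bigID (fun S => C \subset S))/=; congr (_ + _).
  have QE S : (S \in circuit_flats) && ((S != setT) && circuit_coatom S) && (C \subset S)
      = (~: S \subset ~: C) && (#|~: S| == 1)%N.
    rewrite setCS andbC; apply: andb_id2l => CS; rewrite /circuit_coatom CS inE.
    have -> : C :\: S = set0 by apply/eqP; rewrite setD_eq0.
    rewrite cards0 /= -(inj_eq (@setC_inj G)) setCT -cards_eq0.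
    by case: eqP => // ->; rewrite andbF.
  rewrite -[X in _ *+ X]bin1 -(sum_setC _ _ _ _ QE).
  apply: eq_bigr => S; rewrite QE setCS => /andP[CS /eqP S1].
  rewrite /circuit_wt CS; congr (iter _ _ _).
  have -> : S :\: C = ~: C :\: ~: S by rewrite setDE [RHS]setDE setCK setIC.
  by rewrite cardsD (setIidPr _) ?setCS// S1 subn1.
have QE S : (S \in circuit_flats) && ((S != setT) && circuit_coatom S) && ~~ (C \subset S)
    = (~: S \subset C) && (#|~: S| == 2)%N.
  rewrite inE -(inj_eq (@setC_inj G)) setCT -cards_eq0 /circuit_coatom -[C \subset S]setD_eq0.
  rewrite -cards_eq0 setDE (sameP (@setIidPr _ C (~: S)) eqP) eqEcard subsetIr.
  have := subset_leq_card (subsetIr C (~: S)).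
  by case: ifP => /eqP; lia.
rewrite -cardC -(sum_setC _ _ _ _ QE); apply: eq_bigr => S; rewrite QE => /andP[SC /eqP S2].
rewrite /circuit_wt ifN.
  have := cardsC S; rewrite -(cardsC C) cardC S2 !addSn addnC !addSn add0n => -[->].
  by rewrite addnC /surj_poly iterD.
rewrite -setD_eq0 setDE (setIidPr SC) -cards_eq0 S2.
by [].
Qed.

Lemma sum_circuit_wt :
  \sum_(S in circuit_flats | S != setT) circuit_wt S = iter #|~: C| subdivU (trunc_poly R k).
Proof.
by rewrite -setTD -circuit_wt_below ?subsetT//; apply: eq_bigl => S; rewrite properT.
Qed.

Lemma sum_trunc_circuit_wt :
  \sum_(S in trunc_circuit_flats | S != setT) circuit_wt S = trunc_prod_poly R #|~: C| k.
Proof.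
have := sum_circuit_wt; rewrite (bigID circuit_coatom)/=.
rewrite (eq_bigl (fun S => (S \in circuit_flats) && ((S != setT) && circuit_coatom S))).
  rewrite sum_circuit_coatoms /trunc_prod_poly => <-.
  rewrite (eq_bigl (fun S => (S \in circuit_flats) && (S != setT) && ~~ circuit_coatom S)).
    by ring.
  by move=> S; rewrite inE; case: eqP => //=; rewrite ?andbF ?andbT.
by move=> S; rewrite andbA.
Qed.

(** Only the top lies strictly above a coatom, so truncation does not change the lower
    intervals of the other flats. *)
Lemma trunc_circuit_below S : S \in trunc_circuit_flats -> S != setT ->
  \sum_(T in trunc_circuit_flats | T \proper S) circuit_wt T =
  \sum_(T in circuit_flats | T \proper S) circuit_wt T.
Proof.
rewrite inE => /andP[Sflat _] ST; apply: eq_bigl => T.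
apply: andb_id2r => TS; rewrite inE; apply/andb_idr => Tflat; apply/orP; right.
have ltST : (#|~: S| < #|~: T|)%N by apply: proper_card; rewrite properC.
have S0 : #|~: S| != 0%N.
  by rewrite cards_eq0 -(inj_eq (@setC_inj G)) setCK setC0.
rewrite /circuit_coatom; case: ifP => [_|nCT]; first by move: ltST S0; lia.
apply/negP => /eqP T2.
have CT : C :\: T = ~: T.
  apply/eqP; rewrite eqEcard setDE subsetIr -setDE T2.
  move: Tflat nCT; rewrite inE -[C \subset T]setD_eq0 -cards_eq0; lia.
have CS : C :\: S = ~: S.
  have TC : ~: T \subset C by rewrite -CT subsetDl.
  by rewrite setDE (setIidPr _)// (subset_trans _ TC)// setCS proper_sub.
by move: Sflat; rewrite inE CS; move: ltST S0; rewrite T2; lia.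
Qed.

Section ChainPolynomial.
Context {d : Order.disp_t} (P : finPOrderType d) (phi : P -> {set G}).
Hypothesis phi_le : forall x y : P, (x <= y)%O = (phi x \subset phi y).

Let set0NT : set0 != setT :> {set G}.
Proof.
by rewrite eq_sym -cards_eq0 cardsT -(cardsC C) cardC.
Qed.

Lemma chain_poly_circuit_flats :
  (forall S, reflect (exists x, phi x = S) (S \in circuit_flats)) ->
  chain_poly P R = ('X + 1) ^+ 2 * iter #|~: C| subdivU (trunc_poly R k).
Proof.
move=> phiF; rewrite -sum_circuit_wt.
apply: chain_poly_family phi_le phiF circuit_flats0 circuit_flatsT set0NT circuit_wt0 _.
by move=> S SF S0 _; apply: circuit_wt_rec.
Qed.

Lemma chain_poly_trunc_circuit_flats : (0 < #|~: C| + k)%N ->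
  (forall S, reflect (exists x, phi x = S) (S \in trunc_circuit_flats)) ->
  chain_poly P R = ('X + 1) ^+ 2 * trunc_prod_poly R #|~: C| k.
Proof.
move=> large phiF; rewrite -sum_trunc_circuit_wt.
apply: chain_poly_family phi_le phiF _ _ set0NT circuit_wt0 _.
- rewrite inE circuit_flats0 /circuit_coatom setC0 subset0 -cards_eq0 cardC /=.
  by rewrite cardsT -(cardsC C) cardC orbC; move: large; lia.
- by rewrite inE circuit_flatsT eqxx.
move=> S SF S0 ST; rewrite trunc_circuit_below// circuit_wt_rec//.
by move: SF; rewrite inE => /andP[].
Qed.

End ChainPolynomial.

End CircuitFamilies.

(** * The truncated Boolean algebra and its atoms *)

Section Rank.
Context {d : Order.disp_t} (P : finPOrderType d).
Local Open Scope order_scope.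

(** Upper bound: [rho] is injective on chains. Lower bound: descend along the second
    hypothesis. *)
Lemma rank_unique (rho : P -> nat) :
  (forall x y : P, x < y -> (rho x < rho y)%N) ->
  (forall x, (0 < rho x)%N -> exists2 y : P, y < x & rho x = (rho y).+1) ->
  forall x, rank x = rho x.
Proof.
move=> mono pred x; apply/eqP; rewrite eqn_leq; apply/andP; split.
  apply/bigmax_leqP => C /andP[/forall_inP Cch /forall_inP Cx].
  rewrite cardE -(size_map rho) -[leqRHS](size_iota 0).
  apply: uniq_leq_size => [|k /mapP[y]]; last first.
    by rewrite mem_enum => /Cx /mono yx ->; rewrite mem_iota.
  rewrite map_inj_in_uniq ?enum_uniq// => y z; rewrite !mem_enum => yC zC yz.
  have /forall_inP /(_ _ zC) := Cch _ yC.
  by case: comparableP => // /mono; rewrite yz ltnn.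
have [n] := ubnP (rho x); elim: n x => // n IH x xn.
have [->//|x0] := posnP (rho x); have [y yx xE] := pred x x0.
rewrite xE (leq_ltn_trans (IH y _))//; first by rewrite -ltnS -xE.
exact: lt_rank.
Qed.

End Rank.

Section TruncBool.
Variables (E : finType) (n : nat).
Hypothesis cardE : #|E| = n.+2.
Local Notation L := (trunc_bool E).
Implicit Types (x y z : L) (A B : {set E}) (b : bool).

(** [val] with the carrier [{set E}] written as such. *)
Definition tbset x : {set E} := val x.

Lemma tbset_card x : #|tbset x| != n.+1.
Proof. by have := card_tb x; rewrite cardE. Qed.

Lemma tbset_ex A : #|A| != n.+1 -> exists x : L, tbset x = A.
Proof.
rewrite -[n.+1]/(n.+2.-1) -cardE -in_trunc_bool => AL.
by exists (Sub A AL : trunc_bool E); rewrite /tbset SubK.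
Qed.

Lemma tbset_le x y : (x <= y)%O = (tbset x \subset tbset y).
Proof. exact: tb_leE. Qed.

Lemma tbset_lt x y : (x < y)%O = (tbset x \proper tbset y).
Proof. by rewrite lt_neqAle tbset_le properEneq (inj_eq (@val_inj _ _ L)). Qed.

Lemma tbset_small x : tbset x != setT -> (#|tbset x| <= n)%N.
Proof. by case: (tb_top x) => [|xT]; rewrite ?cardE// /tbset xT eqxx. Qed.

Lemma tb_rank x : rank x = if tbset x == setT then n.+1 else #|tbset x|.
Proof.
apply: (rank_unique (rho := fun x : L => if tbset x == setT then n.+1 else #|tbset x|)).
  move=> {}x y; rewrite tbset_lt => xy.
  case: eqP => [xT|/eqP xT]; first by move: xy; rewrite xT properE subsetT andbF.
  by case: eqP => yT; [apply: tbset_small | apply: proper_card].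
move=> {}x; case: eqP => xT x0.
  have : (0 < #|[set A : {set E} | A \subset setT & #|A| == n]|)%N.
    by rewrite cards_draws cardsT cardE bin_gt0 -addn2 leq_addr.
  case/card_gt0P => A; rewrite inE subsetT /= => /eqP cA.
  have [|y yE] := @tbset_ex A; first by rewrite cA; lia.
  have yT : tbset y != setT.
    by rewrite yE; apply: contra_eq_neq cA => ->; rewrite cardsT cardE; lia.
  exists y; last by rewrite (negPf yT) yE cA.
  by rewrite tbset_lt xT properT.
have x_small : (#|tbset x| <= n)%N by apply/tbset_small/eqP.
have [e ex] := card_gt0P x0.
have cD := cardsD1 e (tbset x); rewrite ex in cD.
have [|y yE] := @tbset_ex (tbset x :\ e); first by lia.
exists y; first by rewrite tbset_lt yE properD1.
by rewrite yE ifN ?cD//; apply/eqP => /setP /(_ e); rewrite !inE eqxx.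
Qed.

(** An atom is a singleton, except for [#|E| = 2], where the atom is [E] itself. *)
Lemma tb_atom_below x e : e \in tbset x ->
  exists2 a : L, atom a && (a <= x)%O & e \in tbset a.
Proof.
move=> ex; have [|bot botE] := @tbset_ex set0; first by rewrite cards0.
have least : is_least bot by apply/forallP => y; rewrite tbset_le botE sub0set.
have atomP (a : L) : e \in tbset a ->
    (forall z : L, (z < a)%O -> tbset z = set0) -> atom a.
  move=> ea az; have a0 : tbset a != set0 by apply/set0Pn; exists e.
  apply/existsP; exists bot; rewrite least /covers tbset_lt botE proper0 a0 /=.
  apply/existsPn => z; rewrite tbset_lt botE proper0; apply/negP => /andP[z0 /az zE].
  by rewrite zE eqxx in z0.
have [n0|n0] := eqVneq n 0%N.
  exists x => //; rewrite lexx andbT; apply: atomP => // z; rewrite tbset_lt => /proper_card zx.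
  apply/eqP; rewrite -cards_eq0; have := tbset_card z; have := subset_leq_card (subsetT (tbset x)).
  by move: zx; rewrite cardsT cardE n0; lia.
have [|a aE] := @tbset_ex [set e]; first by rewrite cards1; lia.
exists a; last by rewrite aE set11.
rewrite tbset_le aE sub1set ex andbT; apply: atomP; first by rewrite aE set11.
move=> z; rewrite tbset_lt aE => /proper_card; rewrite cards1 ltnS leqn0 cards_eq0.
by move/eqP.
Qed.

(** The element of the extension given by the flat [x], with [e] included if [b]. *)
Definition atoms_with x b : {set option L} :=
  [set o | if o is Some a then atom a && (a <= x)%O else b].

(** The three kinds of elements of the extension, in terms of subsets of [E]. *)
Definition ext_flat (M : {set L}) x b := if b then (x \in M) ||
   ~~ [exists y in M, (tbset x \subset tbset y) && (rank y == (rank x).+1)]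
   else x \notin M.

(** The same element as a subset of [E + e], [e] being [None]. *)
Definition ext_set A b : {set option E} := [set o | if o is Some e then e \in A else b].

(** Undoes the encoding of a flat by its set of atoms. *)
Definition ground_of (T : {set option L}) : {set option E} :=
  [set o | if o is Some e then [exists a : L, (Some a \in T) && (e \in tbset a)]
           else None \in T].

Lemma ground_ofE x b : ground_of (atoms_with x b) = ext_set (tbset x) b.
Proof.
apply/setP => -[e|]; rewrite !inE//; apply/existsP/idP => [[a]|ex].
  by rewrite inE tbset_le => /andP[/andP[_ /subsetP ax] /ax].
by have [a ax ea] := tb_atom_below ex; exists a; rewrite inE ax.
Qed.

Lemma ext_set_sub A b B c : (ext_set A b \subset ext_set B c) = (A \subset B) && (b ==> c).
Proof.
apply/subsetP/andP => [AB|[/subsetP AB bc] [e|]]; last 2 first.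
- by rewrite !inE; apply: AB.
- by rewrite !inE; apply/implyP.
split; first by apply/subsetP => e eA; have := AB (Some e); rewrite !inE; apply.
by have := AB None; rewrite !inE => bc; apply/implyP.
Qed.

Lemma atoms_with_sub x b y c :
  (atoms_with x b \subset atoms_with y c) = (ext_set (tbset x) b \subset ext_set (tbset y) c).
Proof.
rewrite ext_set_sub -tbset_le; apply/subsetP/andP => [s|[xy bc] [a|]]; last 2 first.
- by rewrite !inE => /andP[-> /le_trans]; apply.
- by rewrite !inE; apply/implyP.
split; last by have := s None; rewrite !inE => bc; apply/implyP.
rewrite tbset_le; apply/subsetP => e /tb_atom_below[a /andP[aat ax]].
have := s (Some a); rewrite !inE aat ax => /(_ isT)/=.
by rewrite tbset_le => /subsetP; apply.
Qed.

Lemma atoms_belowE x b :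
  (if b then None |: atoms_below x else atoms_below x) = atoms_with x b.
Proof.
have E0 : atoms_below x = atoms_with x false.
  apply/setP => -[a|]; rewrite inE; last by apply/imsetP => -[].
  by apply/imsetP/idP => [[a' a'x [->]]|ax]; [rewrite inE in a'x | exists a; rewrite ?inE].
case: b => //; rewrite E0; apply/setP => -[a|]; rewrite !inE//=.
Qed.

Lemma extension_elementsE (M : {set L}) T :
  reflect (exists x b, ext_flat M x b /\ atoms_with x b = T) (T \in extension_elements M).
Proof.
have subE x y : (atoms_below x \subset atoms_below y) = (tbset x \subset tbset y).
  have /= -> := atoms_belowE x false; have /= -> := atoms_belowE y false.
  by rewrite atoms_with_sub ext_set_sub andbT.
have flatE x : (x \notin M) && ~~ [exists y in M, (atoms_below x \subset atoms_below y)
    && (rank y == (rank x).+1)] = (x \notin M) && ext_flat M x true.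
  rewrite /ext_flat; case: (x \in M) => //=; congr (~~ _); apply: eq_existsb => y.
  by rewrite subE.
apply: (iffP idP) => [|[x [[] [xM <-]]]].
- case/setUP=> [/setUP[]|] /imsetP[x]; rewrite inE.
  + by move=> xM ->; exists x, false; rewrite -atoms_belowE.
  + by move=> xM ->; exists x, true; rewrite -atoms_belowE /ext_flat xM.
  + by rewrite flatE => /andP[_ xM] ->; exists x, true; rewrite -atoms_belowE.
- rewrite -atoms_belowE; have [xM'|xM'] := boolP (x \in M).
    by apply/setUP; left; apply/setUP; right; apply: imset_f; rewrite inE.
  by apply/setUP; right; apply: imset_f; rewrite inE flatE xM' xM.
by rewrite -atoms_belowE; apply/setUP; left; apply/setUP; left; apply: imset_f; rewrite inE.
Qed.

End TruncBool.

(** * The extensions as families of flats *)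

Section ExtensionFamilies.
Variables (E : finType) (n : nat).
Hypothesis cardE : #|E| = n.+2.
Local Notation L := (trunc_bool E).
Implicit Types (x y z : L) (A B : {set E}) (b c : bool) (M : {set L}).

Lemma card_ext_set A b : #|ext_set A b| = (#|A| + b)%N.
Proof.
have -> : ext_set A b = (if b then [set None] else set0) :|: Some @: A.
  apply/setP => -[e|]; rewrite !inE.
    by rewrite (mem_imset _ _ Some_inj); case: b; rewrite !inE.
  have /negPf-> : None \notin Some @: A by apply/imsetP => -[].
  by case: b; rewrite !inE.
rewrite cardsU (_ : _ :&: _ = set0) ?cards0 ?subn0; last first.
  by apply/setP => -[e|]; rewrite !inE; case: b; rewrite !inE//; apply/imsetP => -[].
by rewrite (card_imset _ Some_inj) addnC; case: b; rewrite ?cards1 ?cards0.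
Qed.

Lemma ext_set_setD A b B c : ext_set A b :\: ext_set B c = ext_set (A :\: B) (b && ~~ c).
Proof. by apply/setP => -[e|]; rewrite !inE// andbC. Qed.

Lemma ext_set_setC A b : ~: ext_set A b = ext_set (~: A) (~~ b).
Proof. by apply/setP => -[e|]; rewrite !inE. Qed.

Lemma ext_set_trace (S : {set option E}) : S = ext_set [set e | Some e \in S] (None \in S).
Proof. by apply/setP => -[e|]; rewrite !inE. Qed.

Lemma extension_le M (q r : extension M) :
  (q <= r)%O = (ground_of (val q) \subset ground_of (val r)).
Proof.
have -> : (q <= r)%O = (val q \subset val r) by [].
have /(extension_elementsE cardE)[x [b [_ <-]]] := valP q.
have /(extension_elementsE cardE)[y [c [_ <-]]] := valP r.
by rewrite (atoms_with_sub cardE) !(ground_ofE cardE).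
Qed.

Lemma extension_image M (F : {set {set option E}}) :
  (forall x b, ext_flat M x b = (ext_set (tbset x) b \in F)) ->
  (forall A b, ext_set A b \in F -> #|A| != n.+1) ->
  forall S, reflect (exists q : extension M, ground_of (val q) = S) (S \in F).
Proof.
move=> flatF FL S; apply: (iffP idP) => [SF|[q <-]].
  rewrite [S]ext_set_trace in SF *; have /(tbset_ex cardE)[x xE] := FL _ _ SF.
  rewrite -xE -flatF in SF.
  have xM : atoms_with x (None \in S) \in extension_elements M.
    by apply/(extension_elementsE cardE); exists x, (None \in S).
  by exists (Subposet xM : extension M); rewrite /= (ground_ofE cardE) xE.
have /(extension_elementsE cardE)[x [b [xM <-]]] := valP q.
by rewrite (ground_ofE cardE) -flatF.
Qed.

Lemma ext_flat_set0 x b : ext_flat set0 x b = (ext_set (tbset x) b \in circuit_flats (ext_set setT false)).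
Proof.
rewrite [RHS]inE ext_set_setD card_ext_set andFb addn0 setTD /ext_flat !inE /=.
have := tbset_card cardE x; have := cardsC (tbset x); rewrite cardE => ? ?.
have -> : (if b then ~~ [exists y in (set0 : {set L}), (tbset x \subset tbset y) && (rank y == (rank x).+1)] else true).
  by case: b => //; apply/existsPn => y; rewrite inE.
lia.
Qed.

(** A flat [x] outside the cut is covered by an element of the cut exactly when
    [f :\: x] is a single element, or when [x] has corank one in the truncation and
    its cover is the top. *)
Lemma ext_flat_principal f x b : tbset f != set0 ->
  ext_flat [set z | (f <= z)%O] x b =
  (ext_set (tbset x) b \in trunc_circuit_flats (ext_set (tbset f) true)).
Proof.
move=> f0; have xC := cardsC (tbset x); rewrite cardE in xC.
have xL := tbset_card cardE x.
have fx : (tbset f \subset tbset x) = (#|tbset f :\: tbset x| == 0)%N.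
  by rewrite cards_eq0 setD_eq0.
have xT : (ext_set (tbset x) b == setT) = b && (#|~: tbset x| == 0)%N.
  rewrite -(inj_eq (@setC_inj _)) setCT ext_set_setC -cards_eq0 card_ext_set.
  by case: b; rewrite ?addn0 ?addn1.
have cover : ~~ (tbset f \subset tbset x) ->
    [exists y in [set z | (f <= z)%O], (tbset x \subset tbset y) && (rank y == (rank x).+1)]
    = (#|tbset f :\: tbset x| == 1)%N || (#|~: tbset x| == 2)%N.
  move=> nfx; have xnT : tbset x != setT by apply: contraNneq nfx => ->; apply: subsetT.
  have rx : rank x = #|tbset x| by rewrite (tb_rank cardE) (negPf xnT).
  have cU : #|tbset f :|: tbset x| = (#|tbset f :\: tbset x| + #|tbset x|)%N.
    have := cardsUI (tbset f) (tbset x); have := cardsID (tbset x) (tbset f); lia.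
  have [top topE] : exists y : L, tbset y = setT.
    by apply: (tbset_ex cardE); rewrite cardsT cardE; lia.
  apply/existsP/orP => [[y]|].
    rewrite inE tbset_le rx (tb_rank cardE) => /and3P[fy xy].
    case: (tbset y =P setT) => _ /eqP yx; first by right; apply/eqP; lia.
    have := subset_leq_card (_ : tbset f :|: tbset x \subset tbset y).
    by rewrite subUset fy xy cU => /(_ isT); move: nfx; rewrite fx; left; lia.
  have [x2|xn2] := eqVneq #|~: tbset x| 2%N.
    move=> _; exists top; rewrite inE tbset_le topE !subsetT rx (tb_rank cardE) topE eqxx.
    by apply/eqP; lia.
  case=> // /eqP f1; have [|y yE] := @tbset_ex _ _ cardE (tbset f :|: tbset x).
    by rewrite cU; lia.
  exists y; rewrite inE tbset_le yE subsetUl subsetUr rx (tb_rank cardE) yE.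
  rewrite ifN ?cU ?f1 ?add1n ?eqxx//; apply/eqP => /(congr1 (fun A : {set E} => #|A|)).
  by rewrite /= cU cardsT cardE; lia.
rewrite [RHS]inE inE ext_set_setD card_ext_set /circuit_coatom ext_set_sub ext_set_setC card_ext_set xT.
rewrite /ext_flat; case: b xT => _; rewrite ?implybT ?andbT inE tbset_le /=; last first.
  by rewrite andbF fx; lia.
have [fx'|nfx] := boolP (tbset f \subset tbset x).
  by move: fx'; rewrite fx => /eqP->; lia.
by rewrite cover//; move: nfx; rewrite fx; lia.
Qed.

Lemma trunc_circuit_card f A b : tbset f != set0 ->
  ext_set A b \in trunc_circuit_flats (ext_set (tbset f) true) -> #|A| != n.+1.
Proof.
move=> f0; rewrite inE inE ext_set_setD card_ext_set /circuit_coatom ext_set_sub ext_set_setC card_ext_set.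
have AC := cardsC A; rewrite cardE in AC.
have DA := subset_leq_card (_ : tbset f :\: A \subset ~: A).
rewrite setDE subsetIr -setDE in DA; have {}DA := DA isT.
have fA : (tbset f \subset A) = (#|tbset f :\: A| == 0)%N by rewrite cards_eq0 setD_eq0.
have [pT _|_] := eqVneq (ext_set A b) setT; last first.
  by case: b; rewrite ?andbT ?andbF ?fA /=; try case: ifP; lia.
have : A = setT by apply/setP => e; have /setP/(_ (Some e)) := pT; rewrite !inE.
by move=> ->; rewrite cardsT cardE; lia.
Qed.

Lemma chain_poly_extension_set0 (R : comNzRingType) :
  chain_poly (extension (set0 : {set L})) R =
  ('X + 1) ^+ 2 * iter 1 subdivU (trunc_poly R n).
Proof.
have cC : #|ext_set (setT : {set E}) false| = n.+2 by rewrite card_ext_set cardsT cardE addn0.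
have cC' : #|~: ext_set (setT : {set E}) false| = 1%N by rewrite ext_set_setC card_ext_set setCT cards0.
have := @chain_poly_circuit_flats R _ _ _ cC _ _ _ (@extension_le set0).
rewrite cC'; apply; apply: extension_image ext_flat_set0 _ => A b.
rewrite inE ext_set_setD card_ext_set andFb addn0 setTD => c1.
by have := cardsC A; rewrite cardE; move: c1; lia.
Qed.

Lemma chain_poly_extension_principal (R : comNzRingType) f k : #|tbset f| = k.+1 ->
  chain_poly (extension [set z : L | (f <= z)%O]) R =
  ('X + 1) ^+ 2 * trunc_prod_poly R (n.+1 - k) k.
Proof.
move=> cf; have cC : #|ext_set (tbset f) true| = k.+2 by rewrite card_ext_set cf addn1.
have f0 : tbset f != set0 by rewrite -cards_eq0 cf.
have le_k : (k <= n.+1)%N.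
  by have := subset_leq_card (subsetT (tbset f)); rewrite cardsT cardE cf.
have -> : (n.+1 - k)%N = #|~: ext_set (tbset f) true|.
  by rewrite ext_set_setC card_ext_set addn0; have := cardsC (tbset f); rewrite cardE cf; lia.
apply: (chain_poly_trunc_circuit_flats _ cC (@extension_le _)).
  rewrite ext_set_setC card_ext_set addn0; have := cardsC (tbset f); rewrite cardE cf; lia.
apply: extension_image => [x b|A b]; first exact: ext_flat_principal.
exact: trunc_circuit_card.
Qed.

(** Here [e] belongs to all elements of the extension and can be dropped: the family is
    that of the circuit [E] on [E]. *)
Lemma chain_poly_extension_full (R : comNzRingType) f : tbset f = set0 ->
  chain_poly (extension [set z : L | (f <= z)%O]) R = ('X + 1) ^+ 2 * trunc_poly R n.
Proof.
move=> f0; set M := [set z : L | _].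
have Mx x : x \in M by rewrite inE tbset_le f0 sub0set.
have elt q : q \in extension_elements M -> exists x, ground_of q = ext_set (tbset x) true.
  move=> /(extension_elementsE cardE)[x [[] [xM <-]]]; last by rewrite /ext_flat Mx in xM.
  by exists x; rewrite (ground_ofE cardE).
have trE x : [set e | Some e \in ext_set (tbset x) true] = tbset x.
  by apply/setP => e; rewrite !inE.
pose phi (q : extension M) := [set e | Some e \in ground_of (val q)].
have phi_le q r : (q <= r)%O = (phi q \subset phi r).
  have [[x qx] [y ry]] := (elt _ (valP q), elt _ (valP r)).
  by rewrite extension_le /phi qx ry ext_set_sub andbT !trE.
have cC : #|[set: E]| = n.+2 by rewrite cardsT.
have := @chain_poly_circuit_flats R _ _ _ cC _ _ _ phi_le.
rewrite setCT cards0; apply => S; rewrite inE setTD; apply: (iffP idP) => [c1|[q <-]].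
  have [|x xS] := tbset_ex cardE (A := S).
    by have := cardsC S; rewrite cardE; move: c1; lia.
  have xM : atoms_with x true \in extension_elements M.
    by apply/(extension_elementsE cardE); exists x, true; rewrite /ext_flat Mx.
  exists (Subposet xM : extension M); apply/setP => e.
  by rewrite /phi /= (ground_ofE cardE) !inE xS.
have [x qx] := elt _ (valP q); rewrite /phi qx trE.
by have := tbset_card cardE x; have := cardsC (tbset x); rewrite cardE; lia.
Qed.

End ExtensionFamilies.

Section TotalOrder.
Context {d : Order.disp_t} (P : finPOrderType d) (R : nzRingType).

Lemma chain_poly_total : (forall x y : P, (x >=< y)%O) ->
  chain_poly P R = ('X + 1) ^+ #|P|.
Proof.
move=> tot; rewrite exprD1n /chain_poly poly_def; apply: eq_bigr => k _.
rewrite scaler_nat -card_draws /nb_chains; congr (_ *+ _); apply: eq_card => C.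
rewrite !inE andb_idl// => _; apply/forall_inP => x _; apply/forall_inP => y _.
exact: tot.
Qed.

End TotalOrder.

(** The truncation has a single element and no atoms. *)
Lemma extension_card1_total (E : finType) (M : {set trunc_bool E}) :
  #|E| = 1%N -> forall q r : extension M, (q >=< r)%O.
Proof.
move=> E1; have tbT (x : trunc_bool E) : tbset x = setT.
  apply/eqP; rewrite eqEcard subsetT cardsT E1 /= card_gt0.
  by have := card_tb x; rewrite E1 -cards_eq0.
have below0 (x : trunc_bool E) : atoms_below x = set0.
  apply/setP => o; rewrite inE; apply/imsetP => -[a].
  rewrite inE => /andP[/existsP[z /andP[_ /andP[za _]]] _].
  by move: za; rewrite tbset_lt !tbT properxx.
have elt (q : extension M) : val q = set0 \/ val q = [set None].
  have := valP q; rewrite !inE => /orP[/orP[]|] /imsetP[x _ ->]; rewrite below0.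
  - by left.
  - by right; rewrite setU0.
  - by right; rewrite setU0.
have leE (q r : extension M) : (q <= r)%O = (val q \subset val r) by [].
move=> q r; rewrite /Order.comparable !leE.
by case: (elt q) => ->; case: (elt r) => ->; rewrite ?sub0set ?subxx ?orbT.
Qed.

Theorem corollary6p11 (R : realType) (E : finType) (hE : (0 < #|E|)%N)
    (M : {set trunc_bool E})
    (hM : M = set0 \/ (modular_cut M /\ principal M)) :
  real_rooted (chain_poly (extension M) R) /\
  forall x : R, root (chain_poly (extension M) R) x -> -1 <= x <= 0.
Proof.
have [E1|E1] := eqVneq #|E| 1%N.
  (* A chain of [N] elements has chain polynomial [(1 + t)^N]. *)
  apply: (splits_in_unit_interval (@stable1 R) (hpos_one R)).
  by rewrite mulr1; apply: chain_poly_total; apply: extension_card1_total.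
have [n cardE] : exists n, #|E| = n.+2 by case: #|E| hE E1 => [|[|n]] // _ _; exists n.
case: hM => [->|[_ [f ->]]].
  have sf := @stable_iter_subdivU_trunc_poly R 1 n.
  exact: splits_in_unit_interval sf (@hpos_iter_subdivU_trunc_poly R 1 n)
    (chain_poly_extension_set0 cardE R).
have [f0|] := eqVneq (tbset f) set0.
  have sf := @stable_trunc_poly R n.
  exact: splits_in_unit_interval sf (@hpos_trunc_poly R n)
    (chain_poly_extension_full cardE R f0).
rewrite -card_gt0; case cf: #|tbset f| => [|k] // _.
have le_k : (k < n.+2)%N.
  by have := subset_leq_card (subsetT (tbset f)); rewrite cardsT cardE cf.
have mk : (0 < n.+1 - k + k)%N by rewrite subnK.
have sf := @stable_trunc_prod_poly R _ _ mk.
exact: splits_in_unit_interval sf (@hpos_trunc_prod_poly R _ _ mk)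
  (chain_poly_extension_principal cardE R cf).
Qed.
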